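(* For an arbitrary finite filtration truncated up to dimension $(k+1)$, computing its persistent cup-length diagram via the Main Algorithm (described in the context) has complexity at most $$O\big((m_k)^2\cdot q_1\cdot q_{k-1}\cdot\max\{c_k,q_1\}\big).$$ In terms of just $m_k$, the complexity of the Main Algorithm is at most $O((m_k)^{k+3})$, since $c_k\le m_k$ and $q_{k-1}\le (m_k)^{k-1}$. For the $(k+1)$-dimensional truncation of the Vietoris-Rips filtration arising from a metric space of $n$ points, the complexity of the Main Algorithm is improved to $O((m_k)^2\cdot q_1^2\cdot q_{k-1})$, which is at most $O((m_k)^{k+3})\le O(n^{k^2+5k+6})$.
   Context: Fix a positive integer $k$ (a constant). Let $\mathbf{X}:\mathbb{X}_1\hookrightarrow\cdots\hookrightarrow\mathbb{X}_N=\mathbb{X}$ be a finite filtration of a finite simplicial complex with ordered vertices. Its $(k+1)$-dimensional truncation is the filtration by the $(k+1)$-skeleta $\mathbb{X}_i^{k+1}$; its barcode is identified with that of $\mathbf{X}$ in degrees $\le k$. Cohomology is simplicial with $\mathbb{Z}_2$-coefficients. $\mathcal{B}_{[1,k]}(\mathbf{X})=\sqcup_{1\le p\le k}\mathcal{B}_p(\mathbf{X})$, where $\mathcal{B}_p(\mathbf{X})$ is the multiset of intervals (bars) in the interval decomposition of $\mathbf{H}^p(\mathbf{X})$. Bars are taken closed at the right end (replacing a right end by the closest critical value to the left if needed). Persistent cup-length diagram. A family of representative cocycles $\boldsymbol{\sigma}$ assigns to each bar $I\in\mathcal{B}_p(\mathbf{X})$ with right end $d$ a $p$-cocycle $\sigma_I$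 of $\mathbb{X}_d$ such that, writing $[\sigma_I]_t$ for the class of its restriction to $\mathbb{X}_t$ if $t\le d$ and $[\sigma_I]_t=0$ if $t>d$, the set $\{[\sigma_I]_t: t\in I\in\mathcal{B}_p(\mathbf{X})\}$ is a basis of $\mathbf{H}^p(\mathbb{X}_t)$ for every $t$. For bars $I_1,\dots,I_\ell$, put $I_1*_{\boldsymbol{\sigma}}\cdots*_{\boldsymbol{\sigma}}I_\ell=\{t: [\sigma_{I_1}]_t\smile\cdots\smile[\sigma_{I_\ell}]_t\ne0\}$ (the support of the product), annotated with the cochain $\sigma_{I_1}\smile\cdots\smile\sigma_{I_\ell}$. When non-empty it is an interval whose right end is the right end of $\bigcap_i I_i$ and whose left end is the left end of some bar. $(\mathcal{B}_{[1,k]}(\mathbf{X}))^{*_{\boldsymbol{\sigma}}\ell}$ is the set of all such (annotated, non-empty) products with each $I_i\in\mathcal{B}_{[1,k]}(\mathbf{X})$. The persistent cup-length diagram is the function on intervals $$I\mapsto\max\{\ell\ge1 : I=I_1*_{\boldsymbol{\sigma}}\cdots*_{\boldsymbol{\sigma}}I_\ell,\ I_i\in\mathcal{B}_{[1,k]}(\mathbf{X})\},\qquad \max\emptyset=0.$$ Parameters. $m_k$ is the number of simplices of positive dimension in $\mathbb{X}^{k+1}$; $c_k$ is the complexity of checking whether a simplex is alive at a given filtration parameter; $q_{k-1}:=\max_{1\le\ell\le k-1}\operatorname{card}\big((\mathcal{B}_{[1,k]}(\mathbf{X}))^{*_{\boldsymbol{\sigma}}\ell}\big)$; in particular $q_1=\operatorname{card}(\mathcal{B}_{[1,k]}(\mathbf{X}))$.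 Matrices. Simplices are totally ordered, and $S^*$ is the list of cosimplices (duals of simplices) of dimensions $1$ to $k+1$ in the reverse order. $A$ is the coboundary matrix over $\mathbb{Z}_2$ in the ordered basis $S^*$; $R=AV$ is its reduced form under left-to-right column operations ($V$ upper triangular, pivots of distinct non-zero columns distinct); $\mathrm{Pivots}(R)$ is the set of pivot row indices. $U$ is the upper triangular matrix of the bottom-to-top row reduction, using the rows with index in $\mathrm{Pivots}(R)$, such that $UR$ has at most one non-zero element in each row and column. A cochain with coordinate vector $y$ in $S^*$ is a coboundary iff the non-zero positions of $Uy$ lie in $\mathrm{Pivots}(R)$. Main Algorithm. Input: $k$, $S^*$, $R$, and $\mathcal{B}_{[1,k]}=\{(b_\sigma,d_\sigma,\sigma)\}_{\sigma\in\boldsymbol{\sigma}}$, where each bar (birth time $b_\sigma$, death time $d_\sigma$) is annotated by its representative cocycle and bars are ordered by increasing death time and then by increasing birth time. Output: a matrix $A_\ell$ representing the persistent cup-length diagram (rows indexed by distinct birth times, columns by distinct death times) and the lists of distinct birth times $b_1<b_2<\cdots$ and distinct death times $d_1<d_2<\cdots$. (1) Set $\ell=1$, $B_1=\mathcal{B}_{[1,k]}$, and $A_0=A_1=0$. Compute $U$ from $R$ by row reduction (cost $O(m_k^2)$). For each bar of $B_1$ with birth $b_i$ and death $d_j$ set $A_1(i,j)=1$. (2) While $A_{\ell-1}\ne A_\ell$ and $\ell\le k-1$: start with $B_{\ell+1}=\emptyset$ and $A_{\ell+1}=A_\ell$, and for each $(b_{i_1},d_{j_1},\sigma_1)\in B_1$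 and $(b_{i_2},d_{j_2},\sigma_2)\in B_\ell$, with $d:=d_{\min\{j_1,j_2\}}$: (a) compute the cochain $\sigma=\sigma_1\smile\sigma_2$ by looping over all pairs of a cosimplex of $\sigma_1$ and a cosimplex of $\sigma_2$; when the last vertex of the first is the first vertex of the second, concatenate them and add the result to $\sigma$ if it is a simplex of the complex (cost $O(m_k^2 c_k)$); (b) let $y$ be the coordinate vector of $\sigma$ in $S^*$; (c) find the left end of the support of $\sigma$, i.e. the smallest birth time $b_i\le d$ at which the restriction of $\sigma$ is not a coboundary: start at $i=\max\{i':b_{i'}\le d\}$ and decrease $i$ step by step, at each $i$ testing, with $s_i$ the number of simplices alive at $b_i$, whether the non-zero positions of the product of the bottom-right $s_i\times s_i$ submatrix of $U$ with the last $s_i$ entries of $y$ lie in $\mathrm{Pivots}(R)$ (total cost $O(m_k^2 q_1)$); (d) if the resulting support $[b_i,d]$ is non-empty, append $(b_i,d,\sigma)$ to $B_{\ell+1}$ and set $A_{\ell+1}(i,\min\{j_1,j_2\})=\ell+1$. Then replace $\ell$ by $\ell+1$. (3) Return $A_\ell$ and the lists of birth and death times. For a finite metric space, the Vietoris-Rips complex at scale $t$ consists of the non-empty subsets of diameter at most $t$; there, whether a simplex is alive at $t$ is checked by comparing $t$ with the maximal entry of the corresponding submatrix of the distance matrix. *)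

(* Defs.v *)
From mathcomp Require Import all_boot all_order all_algebra.
Set Implicit Arguments.
Unset Strict Implicit.
Unset Printing Implicit Defensive.
Import Order.TTheory GRing.Theory Num.Theory.

(* Vertices are 'I_n, ordered as integers; simplices are non-empty vertex
   sets.  Filtration parameters are the indices of the N.+1 stages, so that
   bars are closed integer intervals. *)
Record filtration (n N : nat) := Filtration {
  stage :> 'I_N.+1 -> {set {set 'I_n}};
  stage_neq0 : forall t, set0 \notin stage t;
  stage_face : forall t (rho tau : {set 'I_n}),
    tau \in stage t -> rho \subset tau -> rho != set0 -> rho \in stage t;
  stage_mono : forall s t : 'I_N.+1, s <= t -> stage s \subset stage t }.

Section Truncation.
Variables (n N k : nat) (X : filtration n N).

Definition skel (t : 'I_N.+1) : {set {set 'I_n}} :=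
  [set tau in X t | #|tau| <= k.+2].

Lemma skel_neq0 t : set0 \notin skel t.
Proof. by rewrite inE negb_and stage_neq0. Qed.

Lemma skel_face t (rho tau : {set 'I_n}) :
  tau \in skel t -> rho \subset tau -> rho != set0 -> rho \in skel t.
Proof.
rewrite !inE => /andP[Xtau dim_tau] sub_rho rho0.
by rewrite (stage_face Xtau) // (leq_trans (subset_leq_card sub_rho)).
Qed.

Lemma skel_mono (s t : 'I_N.+1) : s <= t -> skel s \subset skel t.
Proof.
move=> le_st; apply/subsetP => tau; rewrite !inE => /andP[Xtau ->].
by rewrite (subsetP (stage_mono X le_st)).
Qed.

(* The filtration by (k+1)-skeleta. *)
Definition trunc := Filtration skel_neq0 skel_face skel_mono.

Definition pos_simplices : {set {set 'I_n}} :=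
  [set tau in trunc ord_max | 1 < #|tau|].

Definition m_ : nat := #|pos_simplices|.

End Truncation.

Section Cohomology.
Variable n : nat.

(* Cochains with coefficients in Z_2; those of a complex K vanish off K. *)
Definition cochain := {ffun {set 'I_n} -> 'F_2}.

Implicit Types (K : {set {set 'I_n}}) (f g : cochain) (p q : nat).

Definition is_cochain K p f :=
  [forall tau, (f tau != 0%R) ==> (tau \in K) && (#|tau| == p.+1)].

Definition restrict K f : cochain :=
  [ffun tau => if tau \in K then f tau else 0%R].

Definition cobound K f : cochain :=
  [ffun tau => if tau \in K then \sum_(v in tau) f (tau :\ v) else 0]%R.

Definition is_cocycle K p f := is_cochain K p f && (cobound K f == 0%R).

Definition is_coboundary K p f :=
  if p is p'.+1 then [exists g, is_cochain K p' g && (cobound K g == f)]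
  else f == 0%R.

(* The classes of the z i, i in J, form a basis of H^p(K).  A linear
   combination over Z_2 is a sum over a subset F of J. *)
Definition cohomology_basis K p (I : finType) (J : {set I}) (z : I -> cochain) :=
  [/\ forall i, i \in J -> is_cocycle K p (z i),
      forall f, is_cocycle K p f ->
        exists2 F : {set I}, F \subset J &
          is_coboundary K p (f - \sum_(i in F) z i)%R
    & forall F : {set I}, F \subset J ->
        is_coboundary K p (\sum_(i in F) z i)%R -> F = set0].

(* [enum] lists the vertices of a simplex in increasing order. *)
Definition front p (tau : {set 'I_n}) := [set v in take p.+1 (enum tau)].
Definition back p (tau : {set 'I_n}) := [set v in drop p (enum tau)].

Definition cup K p f q g : cochain :=
  [ffun tau => if (tau \in K) && (#|tau| == (p + q).+1)
               then f (front p tau) * g (back p tau) else 0]%R.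

Definition unit_cochain K : cochain :=
  [ffun tau => ((tau \in K) && (#|tau| == 1))%:R%R].

Definition cups K (s : seq (nat * cochain)) : cochain :=
  (foldr (fun x y => (x.1 + y.1, cup K x.1 x.2 y.1 y.2))
         (0, unit_cochain K) s).2.

End Cohomology.

(* ((p, b), d) is the bar [b, d] in degree p. *)
Definition bar (N : nat) : Type := (nat * 'I_N.+1 * 'I_N.+1)%type.
Definition deg N (I : bar N) := I.1.1.
Definition birth N (I : bar N) := I.1.2.
Definition death N (I : bar N) := I.2.

Section Barcode.
Variables (n N k : nat) (Y : filtration n N) (Q : nat).
Variables (B : Q.-tuple (bar N)).
Implicit Types (sigma : 'I_Q -> cochain n) (t : 'I_N.+1) (i : 'I_Q).

Definition dg i := deg (tnth B i).
Definition br i := birth (tnth B i).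
Definition dt i := death (tnth B i).

Definition representative_cocycles sigma :=
  (forall i, is_cocycle (Y (dt i)) (dg i) (sigma i)) /\
  (forall p t, 1 <= p <= k ->
     cohomology_basis (Y t) p [set i | (dg i == p) && (br i <= t <= dt i)]
       (fun i => restrict (Y t) (sigma i))).

(* B is the multiset B_[1,k](Y): an interval decomposition of H^p(Y) amounts
   to classes at the right ends of the bars which restrict to a basis at each
   parameter and to zero to the left of their bar. *)
Definition is_barcode :=
  [/\ forall i, 1 <= dg i <= k,
      forall i, br i <= dt i
    & exists2 rho, representative_cocycles rho &
        forall i t, t < br i ->
          is_coboundary (Y t) (dg i) (restrict (Y t) (rho i))].

Definition bar_le (I J : bar N) :=
  (death I < death J) || ((death I == death J) && (birth I <= birth J)).

Variable sigma : 'I_Q -> cochain n.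

Section Product.
Variables (l : nat) (I : l.-tuple 'I_Q).

Definition factors K := [seq (dg i, restrict K (sigma i)) | i <- I].

Definition support_prod : {set 'I_N.+1} :=
  [set t : 'I_N.+1 | all (fun i => t <= dt i) I &&
     ~~ is_coboundary (Y t) (\sum_(i <- I) dg i) (cups (Y t) (factors (Y t)))].

(* The product of the cochains is taken on the largest stage on which all the
   factors are defined. *)
Definition cochain_prod : cochain n :=
  let K := \bigcap_(i <- I) Y (dt i) in cups K (factors K).

End Product.

Definition products (l : nat) : {set {set 'I_N.+1} * cochain n} :=
  [set (support_prod I, cochain_prod I)
     | I in [set I : l.-tuple 'I_Q | support_prod I != set0]].

Definition q_ (r : nat) : nat := \max_(1 <= l < r.+1) #|products l|.

End Barcode.

Section Matrices.
Variables (m : nat).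
Implicit Types (A R V : 'M['F_2]_m).

Definition coboundary_mx n (S : m.-tuple {set 'I_n}) : 'M['F_2]_m :=
  \matrix_(i, j) ((tnth S j \subset tnth S i) &&
                  (#|tnth S i| == #|tnth S j|.+1))%:R%R.

Definition is_pivot R (i j : 'I_m) :=
  (R i j != 0%R) && [forall i' : 'I_m, (i < i') ==> (R i' j == 0%R)].

Definition reduced_form A R :=
  (exists2 V, R = (A *m V)%R &
     (forall i j : 'I_m, j < i -> V i j = 0%R) /\ (forall i, V i i = 1%R)) /\
  (forall i j j', is_pivot R i j -> is_pivot R i j' -> j = j').

End Matrices.

(* A computation is a result together with the number of elementary steps
   taken to obtain it. *)
Definition comp (A : Type) : Type := (A * nat)%type.
Definition ret A (a : A) : comp A := (a, 0).
Definition bind A B (x : comp A) (f : A -> comp B) : comp B :=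
  ((f x.1).1, x.2 + (f x.1).2).
Definition tick (c : nat) : comp unit := (tt, c).

Notation "'let*' x ':=' e 'in' f" := (bind e (fun x => f))
  (at level 200, x name, e at level 200, f at level 200).
Notation "e ';;' f" := (bind e (fun _ => f))
  (at level 199, f at level 200, right associativity).

Fixpoint loop I A (s : seq I) (a : A) (f : A -> I -> comp A) : comp A :=
  if s is x :: s' then (let* a' := f a x in loop s' a' f) else ret a.

(* A procedure deciding whether a simplex is alive at a parameter, with its
   own cost. *)
Definition procedure n N := {set 'I_n} -> 'I_N.+1 -> comp bool.

Definition checks_alive n N (Y : filtration n N) (chk : procedure n N) :=
  forall (tau : {set 'I_n}) (t : 'I_N.+1), 1 < #|tau| -> (chk tau t).1 = (tau \in Y t).

(* Worst case over all the queries the procedure accepts. *)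
Definition c_ n N (chk : procedure n N) : nat :=
  \max_(tau : {set 'I_n}) \max_(t : 'I_N.+1) (chk tau t).2.

Fixpoint scan (T : eqType) (x : T) (s : seq T) : comp bool :=
  if s is y :: s' then (tick 1 ;; if y == x then ret true else scan x s')
  else ret false.

(* Linear search among the last entries of S*, those alive at t. *)
Definition scan_check n N (Y : filtration n N) m (S : m.-tuple {set 'I_n})
    : procedure n N :=
  fun tau t => scan tau (drop (m - count (mem (Y t)) S) S).

Record algo_input (n N k : nat) (X : filtration n N) := AlgoInput {
  Sstar : (m_ k X).-tuple {set 'I_n};
  q1 : nat;
  bars : q1.-tuple (bar N);
  sigma : 'I_q1 -> cochain n;
  Rmx : 'M['F_2]_(m_ k X);
  Sstar_uniq : uniq Sstar;
  Sstar_mem : Sstar =i pos_simplices k X;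
  (* Reverse of a total order refining the filtration: the simplices alive at
     t are the last entries. *)
  Sstar_sorted : forall (i j : 'I_(m_ k X)) t, i <= j ->
    tnth Sstar i \in trunc k X t -> tnth Sstar j \in trunc k X t;
  Rmx_reduced : reduced_form (coboundary_mx Sstar) Rmx;
  bars_barcode : is_barcode k (trunc k X) bars;
  bars_sorted : sorted (@bar_le N) bars;
  sigma_repr : representative_cocycles k (trunc k X) bars sigma }.

Arguments sigma {n N k X} a i.

Section RowReduction.
Variables (m : nat) (R : 'M['F_2]_m).

Fixpoint find_pivot (rows : seq 'I_m) (j : 'I_m) : comp (option 'I_m) :=
  if rows is i :: rows' then
    (tick 1 ;; if R i j != 0%R then ret (Some i) else find_pivot rows' j)
  else ret None.

(* The table maps a row index in Pivots(R) to the column having that pivot,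
   and the other row indices to None. *)
Definition pivot_table : comp ('I_m -> option 'I_m) :=
  loop (enum 'I_m) (fun _ => None) (fun tbl j =>
    let* p := find_pivot (rev (enum 'I_m)) j in
    tick 1 ;;
    ret (if p is Some i then (fun x => if x == i then Some j else tbl x)
         else tbl)).

Definition row_add (i i' : 'I_m) (M : 'M['F_2]_m) : 'M['F_2]_m :=
  (\matrix_(r, c) if r == i' then M i' c + M i c else M r c)%R.

(* The second component of the state accumulates U.  An elementary row
   operation is one step. *)
Definition row_reduce (tbl : 'I_m -> option 'I_m) : comp 'M['F_2]_m :=
  let* st :=
    loop (rev (enum 'I_m)) (R, 1%:M%R) (fun st i =>
      tick 1 ;;
      if tbl i is Some j then
        loop [seq i' : 'I_m <- enum 'I_m | i' < i] st (fun st i' =>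
          tick 1 ;;
          if st.1 i' j != 0%R
          then tick 1 ;; ret (row_add i i' st.1, row_add i i' st.2)
          else ret st)
      else ret st)
  in ret st.2.

Definition last_indices (s : nat) : seq 'I_m :=
  [seq r : 'I_m <- enum 'I_m | m - s <= r].

Definition dot (U : 'M['F_2]_m) (y : 'cV['F_2]_m) (s : nat) (r : 'I_m)
    : comp 'F_2 :=
  loop (last_indices s) 0%R (fun v c =>
    tick 1 ;; ret (v + U r c * y c 0)%R).

Definition coboundary_test (tbl : 'I_m -> option 'I_m) U y (s : nat)
    : comp bool :=
  loop (last_indices s) true (fun ok r =>
    let* v := dot U y s r in
    tick 1 ;; ret (ok && ((v == 0%R) || (tbl r != None)))).

End RowReduction.

Section MainAlgorithm.
Variables (n N k : nat) (X : filtration n N) (In : algo_input k X).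
Variable chk : procedure n N.

Local Notation time := 'I_N.+1.
Local Notation m := (m_ k X).
Local Notation table := ('I_m -> option 'I_m).
Local Notation abar := (time * time * cochain n)%type.

Fixpoint insert_time (x : time) (s : seq time) : comp (seq time) :=
  if s is y :: s' then
    tick 1 ;;
    if x < y then ret (x :: s)
    else if x == y then ret s
    else let* s'' := insert_time x s' in ret (y :: s'')
  else ret [:: x].

Definition sort_times (s : seq time) : comp (seq time) :=
  loop s [::] (fun acc x => tick 1 ;; insert_time x acc).

Definition lookup (x : time) (s : seq time) : comp nat :=
  tick (size s) ;; ret (index x s).

Definition set_entry (M : seq (seq nat)) (i j v : nat) : comp (seq (seq nat)) :=
  tick 1 ;; ret (set_nth [::] M i (set_nth 0 (nth [::] M i) j v)).

Definition count_alive (t : time) : comp nat :=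
  loop (Sstar In) 0 (fun s tau =>
    tick 1 ;; let* a := chk tau t in ret (s + a)).

Definition concatenable (a b : {set 'I_n}) :=
  [exists v in a :&: b,
     [forall u in a, u <= v] && [forall u in b, v <= u]].

Definition cosimplices (f : cochain n) := enum [set tau | f tau != 0%R].

Definition add_cosimplex (tau : {set 'I_n}) (f : cochain n) : cochain n :=
  [ffun x => f x + (x == tau)%:R]%R.

(* The product is formed on the complex at the parameter d. *)
Definition cup_product (d : time) (f g : cochain n) : comp (cochain n) :=
  loop (cosimplices f) 0%R (fun h a =>
    tick 1 ;;
    loop (cosimplices g) h (fun h b =>
      tick 1 ;;
      if concatenable a b then
        let* alive := chk (a :|: b) d in
        if alive then tick 1 ;; ret (add_cosimplex (a :|: b) h) else ret h
      else ret h)).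

Definition coordinates (f : cochain n) : comp 'cV['F_2]_m :=
  tick m ;; ret (\col_i f (tnth (Sstar In) i))%R.

(* cands: birth times in decreasing order, with the numbers s_i. *)
Fixpoint descend (tbl : table) U y (cands : seq (time * nat))
    (found : option time) : comp (option time) :=
  if cands is (b, s) :: cands' then
    let* cob := coboundary_test tbl U y s in
    tick 1 ;;
    if cob then ret found else descend tbl U y cands' (Some b)
  else ret found.

Definition left_end (tbl : table) U y (bs : seq (time * nat)) (d : time)
    : comp (option time) :=
  tick (size bs) ;;
  descend tbl U y (rev [seq x : time * nat <- bs | x.1 <= d]) None.

(* The B_l are sets: repeated elements are stored once.  The charge is that of
   a dictionary: a binary tree branching on the m coordinates of the cochain,
   then an array indexed by d (which together determine b). *)
Definition insert_bar (x : abar) (B : seq abar) : comp (seq abar) :=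
  tick m.+1 ;; ret (if x \in B then B else rcons B x).

Definition copy_mx (nb nd : nat) (M : seq (seq nat)) : comp (seq (seq nat)) :=
  tick (nb * nd) ;; ret M.

Definition B1 : seq abar :=
  [seq (br (bars In) i, dt (bars In) i, sigma In i) | i <- enum 'I_(q1 In)].

Definition extend (tbl : table) U (bs : seq (time * nat)) (ds : seq time)
    (l : nat) (Bl : seq abar) (M : seq (seq nat))
    : comp (seq abar * seq (seq nat)) :=
  let* M0 := copy_mx (size bs) (size ds) M in
  loop B1 ([::], M0) (fun st x1 =>
    tick 1 ;;
    loop Bl st (fun st x2 =>
      let d := if x1.1.2 <= x2.1.2 then x1.1.2 else x2.1.2 in
      tick 1 ;;
      let* f := cup_product d x1.2 x2.2 in
      let* y := coordinates f in
      let* e := left_end tbl U y bs d in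
      if e is Some b then
        let* B' := insert_bar (b, d, f) st.1 in
        let* i := lookup b (unzip1 bs) in
        let* j := lookup d ds in
        let* M' := set_entry st.2 i j l.+1 in
        ret (B', M')
      else ret st)).

(* Mprev, M: the matrices A_(l-1), A_l.  Since l increases from 1 and stays
   at most k, the fuel k is never exhausted. *)
Fixpoint while_loop (fuel : nat) (tbl : table) U bs ds (l : nat)
    (Bl : seq abar) (Mprev M : seq (seq nat)) : comp (seq (seq nat)) :=
  tick (size bs * size ds).+1 ;;
  if fuel is fuel'.+1 then
    if (Mprev != M) && (l <= k.-1) then
      let* r := extend tbl U bs ds l Bl M in
      while_loop fuel' tbl U bs ds l.+1 r.1 M r.2
    else ret M
  else ret M.

Definition main_algorithm : comp (seq (seq nat) * seq time * seq time) :=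
  let* births := sort_times [seq x.1.1 | x <- B1] in
  let* ds := sort_times [seq x.1.2 | x <- B1] in
  let* bs := loop births [::] (fun bs b =>
               let* s := count_alive b in tick 1 ;; ret (rcons bs (b, s))) in
  let* tbl := pivot_table (Rmx In) in
  let* U := row_reduce (Rmx In) tbl in
  let* M0 := copy_mx (size bs) (size ds)
               (nseq (size bs) (nseq (size ds) 0)) in
  let* M1 := copy_mx (size bs) (size ds) M0 in
  let* M1 := loop B1 M1 (fun M x =>
               let* i := lookup x.1.1 (unzip1 bs) in
               let* j := lookup x.1.2 ds in
               set_entry M i j 1) in
  let* M := while_loop k tbl U bs ds 1 B1 M0 M1 in
  ret (M, births, ds).

Definition complexity : nat := main_algorithm.2.

End MainAlgorithm.

(* q_(k-1), the products being those of the annotated bars of the input. *)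
Definition q_prev n N k (X : filtration n N) (In : algo_input k X) : nat :=
  q_ (trunc k X) (bars In) (sigma In) k.-1.

(* The quantities inside O(...) are read as positive. *)
Definition ge1 (x : nat) : nat := maxn 1 x.

Section VietorisRips.
Local Open Scope ring_scope.
Variables (R : realDomainType) (n : nat) (dist : 'I_n -> 'I_n -> R).

Definition vr_complex (r : R) : {set {set 'I_n}} :=
  [set tau : {set 'I_n} | (tau != set0) &&
     [forall x in tau, forall y in tau, dist x y <= r]].

Definition vr_values : seq R :=
  sort <=%R (undup [seq dist x y | x <- enum 'I_n, y <- enum 'I_n]).

Definition vr_last : nat := (size vr_values).-1.

Definition vr_scale (t : 'I_vr_last.+1) : R := nth 0 vr_values t.

Definition vr_stage t := vr_complex (vr_scale t).

Lemma vr_stage_neq0 t : set0 \notin vr_stage t.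
Proof. by rewrite inE eqxx. Qed.

Lemma vr_stage_face t (rho tau : {set 'I_n}) :
  tau \in vr_stage t -> rho \subset tau -> rho != set0 -> rho \in vr_stage t.
Proof.
rewrite !inE => /andP[_ /forall_inP diam] /subsetP sub_rho ->.
apply/forall_inP => x /sub_rho /diam /forall_inP diamx.
by apply/forall_inP => y /sub_rho /diamx.
Qed.

Lemma vr_stage_mono (s t : 'I_vr_last.+1) :
  (s <= t)%N -> vr_stage s \subset vr_stage t.
Proof.
move=> le_st; apply/subsetP => tau; rewrite !inE => /andP[-> /forall_inP diam].
have le_scale : vr_scale s <= vr_scale t.
  have [->|ne_st] := eqVneq s t; first exact: lexx.
  have lt_st : (s < t)%N by rewrite ltn_neqAle le_st andbT.
  have lt_t : (t < size vr_values)%N.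
    rewrite (leq_trans (ltn_ord t)) // /vr_last prednK //.
    have le_t : (t <= (size vr_values).-1)%N by rewrite -ltnS ltn_ord.
    have /leq_trans : (0 < t)%N := leq_ltn_trans (leq0n s) lt_st.
    by move=> /(_ _ le_t) /leq_trans; apply; exact: leq_pred.
  apply: (sorted_leq_nth le_trans lexx 0 (sort_sorted le_total _)) => //.
  exact: leq_ltn_trans le_st lt_t.
apply/forall_inP => x /diam /forall_inP diamx; apply/forall_inP => y /diamx.
by move=> /le_trans; apply.
Qed.

Definition vr_filtration := Filtration vr_stage_neq0 vr_stage_face vr_stage_mono.

(* Counting vertices up to k+3 suffices to reject sets too large to belong to
   the truncation; otherwise the maximal entry of the submatrix of the distance
   matrix is compared with the scale. *)
Definition vr_check (k : nat) : procedure n vr_last :=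
  fun tau t =>
    tick k.+3 ;;
    if (#|tau| <= k.+2)%N then
      let* mx := loop (enum tau) 0 (fun mx x =>
                   loop (enum tau) mx (fun mx y =>
                     tick 1 ;; ret (Num.max mx (dist x y)))) in
      tick 1 ;; ret (mx <= vr_scale t)
    else ret false.

End VietorisRips.

Arguments vr_check {R n} dist k tau t.

(* Main.v *)
Require Import Defs.
From mathcomp Require Import all_boot all_order all_algebra.
From mathcomp Require Import reals topology.
From mathcomp Require Import zify.
Set Implicit Arguments.
Unset Strict Implicit.
Unset Printing Implicit Defensive.

(** The cost of the algorithm is dominated by its main loop.  Its body runs at
    most k - 1 times, and each run treats the pairs of a bar and an element of
    the list B_l.  The work for one pair is the cup product, a double loop over
    at most m_k cosimplices with one query of cost at most c_k inside, and the
    search for the left end, at most q_1 tests of cost O(m_k^2).  Together this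
    is O(m_k^2 max(c_k, q_1)) ([pair_cost_bound]), and there are at most
    q_1 |B_l| pairs.  The preparations, among them the row reduction, cost less
    ([complexity_bound]).

    The bound thus rests on |B_l| <= q_(k-1), which is not a matter of counting
    steps: it says that the algorithm stores nothing but products with non-empty
    support, and each of them once.  The first claim requires the algorithm to be
    correct in two respects.  The double loop must compute the cup product
    ([cup_product_res]), and the matrix test must recognize every coboundary of
    degree at least two ([coboundary_test_coboundary]), so that a product with a
    non-empty computed support is not a coboundary at its right end.  If y = Ax
    is a coboundary, then y = R x' because V is invertible, and the rows of UR
    that carry no pivot vanish, hence so do these entries of Uy; U being
    triangular, nothing changes when only the simplices alive at a given time
    are kept.  The second claim holds because the support determines the right
    end of a product, which together with the cochain determines the left end
    that is computed ([extend_spec], [size_product_list]).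

    The bounds in m_k alone follow from q_1 <= m_k, as products of l bars number
    at most q_1^l.  The bars of degree p born at time b give independent classes
    that vanish on the preceding stage.  They are represented by cocycles
    relative to that stage, which are sets of p-simplices entering at b;
    counting the subsets on both sides gives at least as many such simplices as
    bars ([card_bars_born]).  As every simplex enters once, summing over b and p
    gives the inequality ([card_bars_le]).

    For a Vietoris-Rips filtration a query concerns at most k + 2 vertices and so
    has constant cost, and m_k <= n^(k+2), because a simplex of the truncation is
    the image of a function on k + 2 elements ([m_le_vertices]). *)

Import Order.TTheory GRing.Theory.

(* The unqualified name would denote composition of functions. *)
Local Notation comp := Defs.comp.

(** * Computations and their cost *)

Lemma bind_res A B (x : comp A) (f : A -> comp B) : (bind x f).1 = (f x.1).1.
Proof. by []. Qed.

Lemma bind_cost A B (x : comp A) (f : A -> comp B) :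
  (bind x f).2 = x.2 + (f x.1).2.
Proof. by []. Qed.

(** The cost of a step may depend on an invariant of the state, which is why
    correctness and cost are handled together. *)
Lemma loop_rule (I : eqType) A (P : A -> Prop) c (s : seq I) a f :
  P a -> (forall a x, x \in s -> P a -> P (f a x).1 /\ (f a x).2 <= c) ->
  P (loop s a f).1 /\ (loop s a f).2 <= size s * c.
Proof.
elim: s a => [|x s IHs] a Pa step //=.
have [Pa' le_c] := step a x (mem_head x s) Pa.
have [||P' le_c'] := IHs (f a x).1 => // [a' y s_y|].
  by apply: step; rewrite inE s_y orbT.
by split=> //; rewrite mulSn leq_add.
Qed.

Lemma loop_cost (I : eqType) A c (s : seq I) a (f : A -> I -> comp A) :
  (forall a x, x \in s -> (f a x).2 <= c) -> (loop s a f).2 <= size s * c.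
Proof.
by move=> le_c; apply: (loop_rule (P := fun=> True) _ _).2 => // ? ? /le_c.
Qed.

Lemma loop_res I A (s : seq I) a (f : A -> I -> comp A) :
  (loop s a f).1 = foldl (fun a x => (f a x).1) a s.
Proof. by elim: s a => //= x s IHs a; rewrite IHs. Qed.

Lemma bind_rule A B (P : B -> Prop) (x : comp A) (f : A -> comp B) c c' :
  x.2 <= c -> P (f x.1).1 /\ (f x.1).2 <= c' ->
  P (bind x f).1 /\ (bind x f).2 <= c + c'.
Proof. by move=> le_c [Pf le_c']; split=> //; apply: leq_add. Qed.

Lemma bind_le A B (x : comp A) (f : A -> comp B) c c' :
  x.2 <= c -> (f x.1).2 <= c' -> (bind x f).2 <= c + c'.
Proof. exact: leq_add. Qed.

(** Here the invariant may mention the part of the list already visited. *)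
Lemma loop_ind (I : eqType) A (P : seq I -> A -> Prop) (s : seq I) a f :
  P [::] a ->
  (forall s1 x b, x \in s -> P s1 b -> P (rcons s1 x) (f b x).1) ->
  P s (loop s a f).1.
Proof.
move=> P0 step; rewrite loop_res; elim/last_ind: s step => [|s x IHs] step //.
rewrite foldl_rcons; apply: (step); first by rewrite mem_rcons mem_head.
by apply: IHs => s1 y b s_y; apply: step; rewrite mem_rcons inE s_y orbT.
Qed.

Lemma loop_sum (I : eqType) (V : nmodType) (s : seq I) (h : V) F (w : I -> V) :
  (forall h x, x \in s -> (F h x).1 = (h + w x)%R) ->
  (loop s h F).1 = (h + \sum_(x <- s) w x)%R.
Proof.
elim: s h => [|x s IHs] h defF /=; first by rewrite big_nil addr0.
rewrite IHs; last by move=> h' y s_y; apply: defF; rewrite inE s_y orbT.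
by rewrite defF ?mem_head // big_cons addrA.
Qed.

Lemma chk_cost n N (chk : procedure n N) tau t : (chk tau t).2 <= c_ chk.
Proof. by rewrite /c_ (bigD1 tau) //= (bigD1 t) //= !leq_max leqnn. Qed.

(** * Cochains *)

Lemma addF2K (x : 'F_2) : (x + x = 0)%R.
Proof. by move: x; case=> [[|[|]]] //= i; apply: val_inj. Qed.

Lemma F2_neq0 (x : 'F_2) : (x != 0)%R -> x = 1%R.
Proof. by case: x => [[|[|]]] //= i _; apply: val_inj. Qed.

Section Cochains.
Local Open Scope ring_scope.
Variable n : nat.
Implicit Types (K : {set {set 'I_n}}) (f g : cochain n) (tau : {set 'I_n}).

Lemma addcK f : f + f = 0.
Proof. by apply/ffunP=> tau; rewrite !ffunE addF2K. Qed.

(** Over Z_2 a cochain is a set of simplices, which makes it possible to count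
    cochains by counting sets. *)
Lemma cochain_eq_supp f g :
  [set tau | f tau != 0] = [set tau | g tau != 0] -> f = g.
Proof.
move=> /setP eq_fg; apply/ffunP => tau; move: (eq_fg tau); rewrite !inE.
have [->|/F2_neq0->] := eqVneq (f tau) 0; first by move/esym/eqP.
by move/esym/F2_neq0.
Qed.

Lemma is_cochainP K p f :
  reflect (forall tau, f tau != 0 -> tau \in K /\ #|tau| = p.+1)
          (is_cochain K p f).
Proof.
apply: (iffP forallP) => [fK tau f0|fK tau].
  by have /implyP/(_ f0)/andP[-> /eqP] := fK tau.
by apply/implyP=> /fK[-> ->]; rewrite eqxx.
Qed.

Lemma coboundD K f g : cobound K (f + g) = cobound K f + cobound K g.
Proof.
apply/ffunP=> tau; rewrite !ffunE; case: ifP => _; last by rewrite addr0.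
by rewrite -big_split; apply: eq_bigr => v _; rewrite ffunE.
Qed.

Lemma cobound0 K : cobound K 0 = 0.
Proof.
apply/ffunP=> tau; rewrite !ffunE; case: ifP => // _.
by rewrite big1 // => v _; rewrite ffunE.
Qed.

Lemma cobound_sum K (I : finType) (F : {set I}) (g : I -> cochain n) :
  cobound K (\sum_(i in F) g i) = \sum_(i in F) cobound K (g i).
Proof.
by apply: (big_morph (cobound K)); [exact: coboundD | exact: cobound0].
Qed.

Lemma is_cochain0 K p : is_cochain K p 0.
Proof. by apply/is_cochainP=> tau; rewrite ffunE eqxx. Qed.

Lemma is_cochainD K p f g :
  is_cochain K p f -> is_cochain K p g -> is_cochain K p (f + g).
Proof.
move=> /is_cochainP fK /is_cochainP gK; apply/is_cochainP=> tau.
rewrite ffunE; have [->|/fK//] := eqVneq (f tau) 0.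
by rewrite add0r => /gK.
Qed.

Lemma is_cochain_sum K p (I : finType) (F : {set I}) (g : I -> cochain n) :
  (forall i, i \in F -> is_cochain K p (g i)) ->
  is_cochain K p (\sum_(i in F) g i).
Proof.
by move=> gK; elim/big_ind: _ => //; [exact: is_cochain0 | exact: is_cochainD].
Qed.

Lemma is_cochain_cobound K p g :
  is_cochain K p g -> is_cochain K p.+1 (cobound K g).
Proof.
move=> /is_cochainP gK; apply/is_cochainP=> tau; rewrite ffunE.
case: ifP => [Ktau|]; last by rewrite eqxx.
have [[v tau_v gv] _|g0] := altP (@exists_inP _ (mem tau) (fun v => g (tau :\ v) != 0)).
  have [_ card_v] := gK _ gv; split=> //.
  by rewrite (cardsD1 v tau) (tau_v : v \in tau) card_v.
rewrite big1 ?eqxx // => v tau_v; apply/eqP; apply: contraNT g0 => gv.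
by apply/exists_inP; exists v.
Qed.

Lemma is_coboundary0 K p : is_coboundary K p 0.
Proof.
case: p => [|p] /=; first exact: eqxx.
by apply/existsP; exists 0; rewrite is_cochain0 cobound0 eqxx.
Qed.

End Cochains.

(** * The number of bars *)

Section RelativeClasses.
Local Open Scope ring_scope.
Variables (n : nat) (K K' : {set {set 'I_n}}) (p : nat).
Hypothesis sK'K : K' \subset K.

(** A class that dies on K' is represented by a cochain relative to K': subtract
    the coboundary of the extension by zero of a primitive on K'. *)
Lemma coboundary_relative (z : cochain n) :
  is_cochain K p.+1 z -> is_coboundary K' p.+1 (restrict K' z) ->
  exists2 g, is_cochain K p g &
    forall tau, (z + cobound K g) tau != 0 ->
      (tau \in K :\: K') && (#|tau| == p.+2)%N.
Proof.
move=> zK /existsP[g /andP[gK' /eqP cob_g]].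
have gK : is_cochain K p g.
  by apply/is_cochainP=> tau /(is_cochainP _ _ _ gK')[/(subsetP sK'K)].
exists g => // tau zg0; have zgK := is_cochainD zK (is_cochain_cobound gK).
have [Ktau ->] := is_cochainP _ _ _ zgK _ zg0.
rewrite eqxx andbT inE Ktau andbT; apply: contraNN zg0 => K'tau.
move/ffunP/(_ tau): cob_g; rewrite !ffunE K'tau Ktau => <-.
by rewrite addF2K.
Qed.

(** The subsets of J correspond to distinct relative cochains: if two of them gave
    the same one, their symmetric difference would be a relation between the
    classes.  Comparing 2 ^ #|J| with the number of relative cochains gives the
    bound without any dimension theory. *)
Lemma card_relative_classes (I : finType) (J : {set I}) (z : I -> cochain n) :
  (forall i, i \in J -> is_cochain K p.+1 (z i)) ->
  (forall i, i \in J -> is_coboundary K' p.+1 (restrict K' (z i))) ->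
  (forall F : {set I}, F \subset J ->
     is_coboundary K p.+1 (\sum_(i in F) z i) -> F = set0) ->
  (#|J| <= #|[set tau in K :\: K' | #|tau| == p.+2]|)%N.
Proof.
move=> zK zK' free_z; set D := [set tau in _ | _].
have /fin_all_exists[g gP] i : exists g, i \in J ->
    is_cochain K p g /\ forall tau, (z i + cobound K g) tau != 0 -> tau \in D.
  have [Ji|_] := boolP (i \in J); last by exists 0.
  have [g gK gD] := coboundary_relative (zK i Ji) (zK' i Ji).
  by exists g => _; split=> // tau /gD; rewrite !inE.
pose w i := z i + cobound K (g i).
have sum_w (F : {set I}) :
    \sum_(i in F) w i = \sum_(i in F) z i + cobound K (\sum_(i in F) g i).
  by rewrite cobound_sum big_split.
pose supp (F : {set I}) := [set tau | (\sum_(i in F) w i) tau != 0].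
have supp_inj : {in powerset J &, injective supp}.
  move=> F G; rewrite !inE => sFJ sGJ /cochain_eq_supp eqFG.
  have sDJ : (F :\: G) :|: (G :\: F) \subset J.
    by rewrite subUset !(subset_trans (subsetDl _ _)).
  have cobD : is_coboundary K p.+1 (\sum_(i in (F :\: G) :|: (G :\: F)) z i).
    apply/existsP; exists (\sum_(i in (F :\: G) :|: (G :\: F)) g i).
    apply/andP; split.
      by apply: is_cochain_sum => i /(subsetP sDJ) /gP[].
    apply/eqP; set E := _ :|: _ in sDJ *.
    suff: \sum_(i in E) z i + cobound K (\sum_(i in E) g i) = 0.
      by move/(congr1 (+%R (\sum_(i in E) z i))); rewrite addrA addcK add0r addr0.
    have disjFG : [disjoint F :\: G & G :\: F].
      rewrite disjoints_subset; apply/subsetP=> i; rewrite !inE => /andP[/negPf-> _].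
      by rewrite andbF.
    rewrite -sum_w (eq_bigl [predU F :\: G & G :\: F]); last first.
      by move=> i; rewrite !inE.
    rewrite bigU //=.
    move: eqFG; rewrite (big_setID G) [RHS](big_setID F) /= setIC => /addrI->.
    by rewrite addcK.
  have /setP D0 := free_z _ sDJ cobD.
  apply/setP=> i; have := D0 i.
  by rewrite !inE; case: (i \in F); case: (i \in G).
have := subset_leq_card (_ : supp @: powerset J \subset powerset D).
rewrite card_in_imset // !card_powerset leq_exp2l //; apply.
apply/subsetP=> _ /imsetP[F sFJ ->]; rewrite inE; apply/subsetP=> tau.
rewrite !inE in sFJ *; apply: contraR => notD; apply/eqP.
rewrite sum_ffunE big1 // => i /(subsetP sFJ) /gP[_ wD]; apply/eqP.
by apply: contraNT notD => /wD; rewrite !inE.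
Qed.

End RelativeClasses.

Lemma restrict_restrict n (K K' : {set {set 'I_n}}) (f : cochain n) :
  K' \subset K -> restrict K' (restrict K f) = restrict K' f.
Proof.
move=> sK'K; apply/ffunP=> tau; rewrite !ffunE.
by case: ifP => // /(subsetP sK'K) ->.
Qed.

Section BarCount.
Variables (n N k : nat) (X : filtration n N).
Variables (Q : nat) (B : Q.-tuple (bar N)).

Lemma trunc_max t : trunc k X t \subset trunc k X ord_max.
Proof. by apply: stage_mono; rewrite -ltnS ltn_ord. Qed.

(** These sets are disjoint, so that a simplex is charged only for bars born at
    one stage. *)
Definition entering (t : 'I_N.+1) : {set {set 'I_n}} :=
  trunc k X t :\: \bigcup_(s : 'I_N.+1 | s < t) trunc k X s.

Lemma entering_inj tau (s t : 'I_N.+1) :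
  tau \in entering s -> tau \in entering t -> s = t.
Proof.
rewrite !inE => /andP[/bigcupP out_s in_s] /andP[/bigcupP out_t in_t].
apply/eqP/negPn/negP; rewrite -val_eqE neq_ltn => /orP[lt|lt].
  by case: out_t; exists s => //; rewrite inE.
by case: out_s; exists t => //; rewrite inE.
Qed.

Lemma stages_before (t : 'I_N.+1) :
  \bigcup_(s : 'I_N.+1 | s < t) trunc k X s = set0 \/
  exists2 s : 'I_N.+1, s < t &
    \bigcup_(s : 'I_N.+1 | s < t) trunc k X s = trunc k X s.
Proof.
have [t0|t_gt0] := posnP t; [left | right].
  by rewrite big_pred0 // => s; rewrite t0.
have lt_t : t.-1 < N.+1 by rewrite (leq_ltn_trans (leq_pred t)).
exists (Ordinal lt_t); first by rewrite /= prednK.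
apply/eqP; rewrite eqEsubset; apply/andP; split.
  apply/bigcupsP=> s lt_st; apply: stage_mono => /=.
  by rewrite -ltnS prednK.
by apply: bigcup_sup; rewrite /= prednK.
Qed.

(** The chosen classes are independent on the stage b and become coboundaries on
    the stage before it. *)
Lemma card_bars_born p (b : 'I_N.+1) : is_barcode k (trunc k X) B ->
  0 < p <= k ->
  #|[set i | (dg B i == p) && (br B i == b)]| <=
  #|[set tau in entering b | #|tau| == p.+1]|.
Proof.
case=> _ le_br [rho [_ basis_rho] vanish] kp.
case: p kp => // p kp.
have [cocycle_z _ free_z] := basis_rho _ b kp.
set J := [set i | _]; set z := fun i => restrict (trunc k X b) (rho i).
have sJ : J \subset [set i | (dg B i == p.+1) && (br B i <= b <= dt B i)].
  apply/subsetP=> i; rewrite !inE => /andP[-> /eqP<-].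
  by rewrite leqnn le_br.
have sub_b : \bigcup_(s : 'I_N.+1 | s < b) trunc k X s \subset trunc k X b.
  by apply/bigcupsP=> s /ltnW le_sb; apply: stage_mono.
apply: (card_relative_classes sub_b (z := z)).
- by move=> i /(subsetP sJ)/cocycle_z/andP[].
- move=> i Ji; rewrite restrict_restrict //.
  have [->|[s lt_sb ->]] := stages_before b.
    rewrite (_ : restrict _ _ = 0%R) ?is_coboundary0 //.
    by apply/ffunP=> tau; rewrite !ffunE inE.
  move: Ji; rewrite inE => /andP[/eqP<- /eqP br_i]; apply: vanish.
  by rewrite br_i.
- by move=> F sFJ; apply: free_z; apply: subset_trans sFJ sJ.
Qed.

(** A bar of degree p is charged to a p-simplex that enters at its birth. *)
Lemma card_bars_le : is_barcode k (trunc k X) B -> Q <= m_ k X.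
Proof.
move=> barB; have [dgB _ _] := barB.
pose inP (pb : 'I_k.+1 * 'I_N.+1) (tau : {set 'I_n}) :=
  (0 < pb.1) && ((tau \in entering pb.2) && (#|tau| == pb.1.+1)).
rewrite -[X in X <= _]card_ord -sum1_card.
rewrite (partition_big (fun i => (inord (dg B i) : 'I_k.+1, br B i)) predT) //=.
have inPP pb pb' tau : inP pb tau -> inP pb' tau -> pb = pb'.
  case: pb pb' => [p b] [p' b'] /andP[_ /andP[/= E /eqP c]] /andP[_ /andP[/= E' /eqP c']].
  congr pair; last exact: entering_inj E E'.
  by apply: val_inj; move: c; rewrite c' => -[].
apply: leq_trans (_ : \sum_(pb : 'I_k.+1 * 'I_N.+1) \sum_(tau | inP pb tau) 1 <= _).
  apply: leq_sum => -[p b] _; rewrite !sum1_card.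
  have dgE i : ((inord (dg B i) : 'I_k.+1) == p) = (dg B i == p :> nat).
    by rewrite -val_eqE /= inordK // ltnS; have /andP[] := dgB i.
  have [p0|p_gt0] := posnP p.
    rewrite eq_card0 // => i. rewrite !unfold_in /= dgE p0.
    by have /andP[] := dgB i; case: (dg B i).
  have kp : 0 < p <= k by rewrite p_gt0 -ltnS ltn_ord.
  have := card_bars_born b barB kp; congr (_ <= _); apply: eq_card => x.
    by rewrite !inE !unfold_in /= dgE.
  by rewrite inE.
rewrite (exchange_big_dep (mem (pos_simplices k X))) /=; last first.
  move=> [p b] tau _ /andP[/= p_gt0 /andP[/setDP[in_b _] /eqP card_tau]].
  by rewrite inE (subsetP (trunc_max b)) // card_tau ltnS.
rewrite /m_ -sum1_card; apply: leq_sum => tau _; rewrite sum1_card.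
by apply/card_le1_eqP => pb pb' in1 in2; exact: inPP in2 in1.
Qed.

End BarCount.

(** * Cup products *)

Section FrontBack.
Variable n : nat.
Implicit Types (a b tau : {set 'I_n}) (p q : nat).

Let lt_ord (u v : 'I_n) := u < v.

Lemma enum_pairwise (A : {set 'I_n}) : pairwise lt_ord (enum A).
Proof.
rewrite {1}/enum_mem -enumT pairwise_filter //.
have -> : pairwise lt_ord (enum 'I_n) = pairwise ltn (map val (enum 'I_n)).
  by rewrite pairwise_map.
by rewrite val_enum_ord -sorted_pairwise ?iota_ltn_sorted //; exact: ltn_trans.
Qed.

Lemma enum_cat (A C D : {set 'I_n}) : A = C :|: D ->
  (forall u v, u \in C -> v \in D -> u < v) -> enum A = enum C ++ enum D.
Proof.
have lt_tr : transitive lt_ord by move=> ? ? ?; apply: ltn_trans.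
move=> -> ltCD; apply: (irr_sorted_eq (leT := lt_ord)) => //.
- by move=> u; rewrite /lt_ord ltnn.
- by rewrite sorted_pairwise // enum_pairwise.
- rewrite sorted_pairwise // pairwise_cat !enum_pairwise !andbT.
  by apply/allrelP=> u v; rewrite !mem_enum; apply: ltCD.
- by move=> u; rewrite mem_cat !mem_enum inE.
Qed.

Lemma set_of_enum (A : {set 'I_n}) : [set u in enum A] = A.
Proof. by apply/setP=> u; rewrite inE mem_enum. Qed.

(** The common vertex is the last of a and the first of b, so a followed by the
    rest of b lists the union in increasing order. *)
Lemma concatenableP p q a b : #|a| = p.+1 -> #|b| = q.+1 ->
  concatenable a b ->
  [/\ #|a :|: b| = (p + q).+1, front p (a :|: b) = a & back p (a :|: b) = b].
Proof.
move=> card_a card_b /existsP[v /and3P[]]; rewrite inE => /andP[av bv].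
move=> /forall_inP le_av /forall_inP le_vb.
have card_av : #|a :\ v| = p by move: card_a; rewrite (cardsD1 v) av => -[].
have card_bv : #|b :\ v| = q by move: card_b; rewrite (cardsD1 v) bv => -[].
have enumF : enum (a :|: b) = enum a ++ enum (b :\ v).
  apply: enum_cat => [|u w /le_av le_u].
    by apply/setP=> u; rewrite !inE; case: eqVneq => // ->; rewrite av.
  rewrite !inE => /andP[neq_w /le_vb le_w]; apply: leq_ltn_trans le_u _.
  by rewrite ltn_neqAle le_w andbT eq_sym.
have enumB : enum (a :|: b) = enum (a :\ v) ++ enum b.
  apply: enum_cat => [|u w].
    by apply/setP=> u; rewrite !inE; case: eqVneq => // ->; rewrite bv orbT.
  rewrite !inE => /andP[neq_u /le_av le_u] /le_vb; apply: leq_trans.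
  by rewrite ltn_neqAle le_u andbT.
split.
- by rewrite cardE enumF size_cat -!cardE card_a card_bv.
- by rewrite /front enumF take_size_cat ?set_of_enum // -cardE.
- by rewrite /back enumB drop_size_cat ?set_of_enum // -cardE.
Qed.

Lemma front_backP p q tau : #|tau| = (p + q).+1 ->
  [/\ #|front p tau| = p.+1, #|back p tau| = q.+1,
      front p tau :|: back p tau = tau & concatenable (front p tau) (back p tau)].
Proof.
move=> card_tau; have size_tau : size (enum tau) = (p + q).+1 by rewrite -cardE.
have card_seq (s : seq 'I_n) : uniq s -> #|[set u in s]| = size s.
  by move=> Us; rewrite cardsE; apply/card_uniqP.
have lt_p : p < size (enum tau) by rewrite size_tau ltnS leq_addr.
split.
- rewrite card_seq ?take_uniq ?enum_uniq // size_take_min.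
  by apply/minn_idPl.
- by rewrite card_seq ?drop_uniq ?enum_uniq // size_drop size_tau subSn ?leq_addr // addKn.
- apply/setP=> u; rewrite !inE -(mem_enum tau) -[in RHS](cat_take_drop p.+1 (enum tau)) mem_cat.
  have [//|notF] := boolP (u \in take _ _).
  rewrite -[p.+1]add1n -drop_drop /=; case E : (drop p (enum tau)) => [|v s] //=.
  rewrite drop0 in_cons orb_idl // => /eqP uv; case/negP: notF.
  rewrite -addn1 takeD E /= take0 mem_cat uv mem_head orbT //.
- have v0 : 'I_n by case: (enum tau) lt_p.
  have defB : drop p (enum tau) = nth v0 (enum tau) p :: drop p.+1 (enum tau).
    exact: drop_nth.
  have := enum_pairwise tau; rewrite -[in enum tau](cat_take_drop p (enum tau)).
  rewrite pairwise_cat => /and3P[/allrelP lt_cat _ pw_drop].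
  apply/existsP; exists (nth v0 (enum tau) p); apply/and3P; split.
  + by rewrite !inE (take_nth v0) // mem_rcons mem_head defB mem_head.
  + apply/forall_inP=> u; rewrite inE (take_nth v0) // mem_rcons inE.
    by case/orP=> [/eqP->//|Fu]; apply/ltnW/lt_cat => //; rewrite defB mem_head.
  + apply/forall_inP=> u; rewrite inE defB inE => /orP[/eqP->//|Bu].
    by move: pw_drop; rewrite defB /= => /andP[/allP/(_ u Bu)/ltnW].
Qed.

End FrontBack.

Section Cup.
Local Open Scope ring_scope.
Variable n : nat.
Implicit Types (K : {set {set 'I_n}}) (f g : cochain n) (p q : nat).

Lemma is_cochain_cup K p q f g : is_cochain K (p + q) (cup K p f q g).
Proof.
apply/is_cochainP=> tau; rewrite ffunE; case: ifP => [/andP[-> /eqP->]//|_].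
by rewrite eqxx.
Qed.

Definition closed_under_faces K :=
  forall tau rho : {set 'I_n}, tau \in K -> rho \subset tau -> rho != set0 -> rho \in K.

Lemma cup_restrict K p q f g : closed_under_faces K ->
  cup K p (restrict K f) q (restrict K g) = cup K p f q g.
Proof.
move=> faceK; apply/ffunP=> tau; rewrite !ffunE.
case: ifP => // /andP[Ktau /eqP/front_backP[card_f card_b union _]].
have sF : front p tau \subset tau by rewrite -{2}union subsetUl.
have sB : back p tau \subset tau by rewrite -{2}union subsetUr.
rewrite (faceK _ _ Ktau sF) -?card_gt0 ?card_f //.
by rewrite (faceK _ _ Ktau sB) -?card_gt0 ?card_b.
Qed.

Lemma restrict_cup K K' p q f g : K' \subset K ->
  restrict K' (cup K p f q g) = cup K' p f q g.
Proof.
move=> sK'K; apply/ffunP=> tau; rewrite !ffunE.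
by case: ifP => // /(subsetP sK'K) ->.
Qed.

Definition degree_sum (s : seq (nat * cochain n)) := (\sum_(x <- s) x.1)%N.

Lemma cups_cons K x s :
  cups K (x :: s) = cup K x.1 x.2 (degree_sum s) (cups K s).
Proof.
rewrite /cups /=; congr cup.
by elim: s => [|y s IHs] /=; rewrite /degree_sum ?big_nil // big_cons IHs.
Qed.

Lemma is_cochain_cups K s : is_cochain K (degree_sum s) (cups K s).
Proof.
case: s => [|x s]; last first.
  by rewrite cups_cons /degree_sum big_cons is_cochain_cup.
apply/is_cochainP=> tau; rewrite ffunE /degree_sum big_nil.
by case: andP => [[-> /eqP->]|_] //; rewrite eqxx.
Qed.

Lemma cups_restrict K K' (s : seq (nat * cochain n)) :
  K' \subset K -> closed_under_faces K' ->
  restrict K' (cups K [seq (x.1, restrict K x.2) | x <- s]) =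
  cups K' [seq (x.1, restrict K' x.2) | x <- s].
Proof.
move=> sK'K faceK'; elim: s => [|x s IHs].
  apply/ffunP=> tau; rewrite !ffunE.
  by case: ifP => // /(subsetP sK'K) ->.
rewrite /= !cups_cons /= restrict_cup // -cup_restrict // IHs restrict_restrict //.
by rewrite /degree_sum !big_map.
Qed.

End Cup.

Section CupProduct.
Variables (n N : nat) (Y : filtration n N) (chk : procedure n N).
Hypothesis chkP : checks_alive Y chk.
Local Open Scope ring_scope.

Lemma sum_indicator (I : finType) (F : {set I}) (x : I) :
  \sum_(a in F) (a == x)%:R = (x \in F)%:R :> 'F_2.
Proof.
rewrite big_mkcond (bigD1 x) //= eqxx big1 ?addr0; first by case: ifP.
by move=> a /negPf->; rewrite if_same.
Qed.

(** The loop over pairs visits each splitting of a simplex into a front and a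
    back face exactly once, so the terms that it adds are those of the
    Alexander-Whitney formula. *)
Lemma cup_product_res d p q K L (f g : cochain n) : (0 < p)%N ->
  is_cochain K p f -> is_cochain L q g ->
  (cup_product chk d f g).1 = cup (Y d) p f q g.
Proof.
move=> p_gt0 /is_cochainP fK /is_cochainP gL.
pose w (a b : {set 'I_n}) : cochain n :=
  if concatenable a b && (a :|: b \in Y d) then add_cosimplex (a :|: b) 0 else 0.
rewrite /cup_product.
have inner a h : a \in cosimplices f ->
    (loop (cosimplices g) h (fun h b => tick 1 ;;
      if concatenable a b then
        let* alive := chk (a :|: b) d in
        if alive then tick 1 ;; ret (add_cosimplex (a :|: b) h) else ret h
      else ret h)).1 = h + \sum_(b <- cosimplices g) w a b.
  rewrite mem_enum inE => /fK[_ card_a]; apply: loop_sum => {}h b _ /=.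
  rewrite /w; case: ifP => _ /=; last by rewrite addr0.
  rewrite chkP; last first.
    by rewrite (leq_trans _ (subset_leq_card (subsetUl a b))) // card_a.
  case: ifP => _ /=; last by rewrite addr0.
  by apply/ffunP=> tau; rewrite !ffunE add0r.
rewrite (loop_sum _ (w := fun a => \sum_(b <- cosimplices g) w a b)); last first.
  by move=> h a fa; rewrite bind_res /= inner.
rewrite add0r; apply/ffunP=> tau; rewrite sum_ffunE big_enum /=.
pose C := (tau \in Y d) && (#|tau| == (p + q).+1).
have wE a b : f a != 0 -> g b != 0 ->
    w a b tau = C%:R * ((a == front p tau)%:R * (b == back p tau)%:R).
  move=> /fK[_ card_a] /gL[_ card_b]; rewrite -!natrM !mulnb.
  have -> : w a b tau = (concatenable a b && (a :|: b \in Y d) && (tau == a :|: b))%:R.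
    by rewrite /w; case: ifP => _; rewrite !ffunE ?add0r.
  rewrite /C; congr (_%:R); congr nat_of_bool; apply/idP/idP.
    case/andP=> /andP[/(concatenableP card_a card_b)[cardU frontU backU] Yab] /eqP->.
    by rewrite Yab cardU frontU backU !eqxx.
  case/andP=> /andP[Yd /eqP/front_backP[_ _ union conc]] /andP[/eqP-> /eqP->].
  by rewrite conc union Yd eqxx.
transitivity (\sum_(a in [set a | f a != 0])
    C%:R * ((a == front p tau)%:R * \sum_(b in [set b | g b != 0]) (b == back p tau)%:R) : 'F_2).
  apply: eq_bigr => a; rewrite inE => fa; rewrite sum_ffunE big_enum /=.
  by rewrite !mulr_sumr; apply: eq_bigr => b; rewrite inE => gb; rewrite wE.
rewrite -mulr_sumr -mulr_suml !sum_indicator !inE !ffunE -/C.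
case: (C); last by rewrite mul0r.
rewrite mul1r; have [->|/F2_neq0->] := eqVneq (f (front p tau)) 0; first by rewrite !mul0r.
by rewrite !mul1r; have [->|/F2_neq0->] := eqVneq (g (back p tau)) 0.
Qed.

Lemma cup_product_cost d m (f g : cochain n) :
  (#|[set tau | f tau != 0%R]| <= m)%N -> (#|[set tau | g tau != 0%R]| <= m)%N ->
  ((cup_product chk d f g).2 <= m * (1 + m * (c_ chk + 2)))%N.
Proof.
move=> card_f card_g.
apply: leq_trans (_ : size (cosimplices f) * (1 + m * (c_ chk + 2)) <= _)%N; last first.
  by rewrite leq_mul2r -cardE card_f orbT.
apply: loop_cost => h a _; rewrite bind_cost /= leq_add2l.
apply: leq_trans (_ : size (cosimplices g) * (c_ chk + 2) <= _)%N; last first.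
  by rewrite leq_mul2r -cardE card_g orbT.
apply: loop_cost => {}h b _; rewrite bind_cost /= addnC [X in (_ <= X)%N]addnC.
case: ifP => _ /=; last by lia.
have := chk_cost chk (a :|: b) d.
by case: (chk _ _).1 => /=; lia.
Qed.

End CupProduct.

(** * Row reduction and the coboundary test *)

Section RowReduction.
Local Open Scope ring_scope.
Variables (m : nat) (R : 'M['F_2]_m).
Hypothesis pivots_distinct :
  forall i j j', is_pivot R i j -> is_pivot R i j' -> j = j'.

Lemma exists_pivot i j : R i j != 0 -> exists i', is_pivot R i' j.
Proof.
move=> Rij; case: (@arg_maxnP _ i (fun i => R i j != 0) (fun i => i) Rij) => i' Ri' maxi'.
exists i'; rewrite /is_pivot Ri'; apply/forall_inP=> i2 lt_i2.
by apply: contraLR lt_i2 => /maxi'; rewrite -leqNgt.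
Qed.

Lemma find_pivotP (rows : seq 'I_m) j :
  pairwise (fun u v : 'I_m => v < u)%N rows ->
  match (find_pivot R rows j).1 with
  | Some i => R i j != 0 /\ forall i', i' \in rows -> (i < i')%N -> R i' j = 0
  | None => forall i, i \in rows -> R i j = 0
  end.
Proof.
elim: rows => //= i rows IHrows /andP[/allP lt_i /IHrows {}IHrows].
case: ifPn => [Rij|/negbNE/eqP Rij] /=.
  split=> // i'; rewrite inE => /orP[/eqP->|/lt_i]; first by rewrite ltnn.
  by move=> lt_i' /(ltn_trans lt_i'); rewrite ltnn.
case: (find_pivot _ _ _).1 IHrows => [i2 [Ri2 below]|zero].
  by split=> // i'; rewrite inE => /orP[/eqP->//|]; apply: below.
by move=> i'; rewrite inE => /orP[/eqP->//|]; apply: zero.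
Qed.

Lemma find_pivot_rows j :
  match (find_pivot R (rev (enum 'I_m)) j).1 return Prop with
  | Some i => is_pivot R i j
  | None => forall i, R i j = 0
  end.
Proof.
have sorted_rev : pairwise (fun u v : 'I_m => v < u)%N (rev (enum 'I_m)).
  have -> : pairwise (fun u v : 'I_m => v < u)%N (rev (enum 'I_m)) =
            sorted gtn (rev (map val (enum 'I_m))).
    rewrite sorted_pairwise; last by move=> ? ? ? /[swap]; apply: ltn_trans.
    by rewrite -map_rev pairwise_map.
  by rewrite val_enum_ord rev_sorted iota_ltn_sorted.
have := @find_pivotP _ j sorted_rev; case: (find_pivot _ _ _).1 => [i [Rij below]|zero].
  rewrite /is_pivot Rij; apply/forall_inP=> i' lt_i; apply/eqP/below => //.
  by rewrite mem_rev mem_enum.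
by move=> i; apply: zero; rewrite mem_rev mem_enum.
Qed.

Lemma pivot_tableP :
  let tbl := (pivot_table R).1 in
  (forall i j, tbl i = Some j -> is_pivot R i j) /\
  (forall i j, is_pivot R i j -> tbl i = Some j).
Proof.
pose P (s : seq 'I_m) (tbl : 'I_m -> option 'I_m) :=
  (forall i j, tbl i = Some j -> is_pivot R i j) /\
  (forall i j, j \in s -> is_pivot R i j -> tbl i = Some j).
suff [sound complete] : P (enum 'I_m) (pivot_table R).1.
  by split=> // i j; apply: complete; rewrite mem_enum.
apply: loop_ind => [|s j tbl _ [sound complete]]; first by split.
rewrite !bind_res /=; have := find_pivot_rows j.
case: (find_pivot _ _ _).1 => [i0 piv|zero] /=; split=> //.
- by move=> i j'; case: eqP => [-> [<-]//|_]; apply: sound.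
- move=> i j'; rewrite mem_rcons inE => s_j' piv'; case: eqP => [eq_i|neq_i].
    by congr Some; apply: pivots_distinct piv _; rewrite -eq_i.
  case/orP: s_j' piv' => [/eqP-> piv'|s_j' piv']; last exact: complete.
  case: neq_i; move: piv piv' => /andP[Ri0 /forall_inP below0] /andP[Ri /forall_inP below].
  case: (ltngtP i i0) => [/below|/below0|/ord_inj//].
    by rewrite (negPf Ri0).
  by rewrite (negPf Ri).
- move=> i j'; rewrite mem_rcons inE => /orP[/eqP->|]; last exact: complete.
  by rewrite /is_pivot zero eqxx.
Qed.

Lemma row_addE (i i' : 'I_m) (M : 'M['F_2]_m) : i' != i ->
  row_add i i' M = (1%:M + delta_mx i' i) *m M.
Proof.
move=> neq_i; rewrite mulmxDl mul1mx; apply/matrixP=> r c; rewrite !mxE.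
rewrite (bigD1 i) //= big1 => [|l /negPf neq_l]; last first.
  by rewrite mxE neq_l andbF mul0r.
by rewrite mxE eqxx andbT addr0; case: eqP => [->|_]; rewrite ?mul1r ?mul0r ?addr0.
Qed.

(** The state of the reduction after the pivots of the rows in s have been used. *)
Definition cleared (s : seq 'I_m) (M : 'M['F_2]_m) := forall i j, is_pivot R i j ->
  M i j != 0 /\ forall i' : 'I_m, (i < i')%N || (i \in s) && (i' != i) -> M i' j = 0.

(** The row added is zero in the columns already cleared and in those whose
    pivot lies above it, so that it disturbs neither of them. *)
Lemma cleared_row_add s (M : 'M['F_2]_m) (i i' j : 'I_m) : is_pivot R i j -> (i' < i)%N ->
  M i' j != 0 -> cleared s M -> cleared s (row_add i i' M).
Proof.
move=> piv lt_i' Mi'j clr i2 j2 piv2; have [Mi2 zero] := clr _ _ piv2.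
have unchanged r : M i j2 = 0 \/ r != i' -> row_add i i' M r j2 = M r j2.
  by case=> [Mij2|/negPf neq_r]; rewrite mxE ?neq_r //; case: eqP => // ->; rewrite Mij2 addr0.
split.
  rewrite unchanged //; have [eq_i2|] := eqVneq i2 i'; [left | by right].
  by apply: zero; rewrite eq_i2 lt_i'.
move=> i3 cond; rewrite unchanged; first exact: zero.
have [eq_i3|] := eqVneq i3 i'; [left | by right].
move: cond; rewrite eq_i3 => /orP[lt_i2|/andP[s_i2 neq_i2]]; apply: (zero).
  by rewrite (ltn_trans lt_i2).
have [eq_i|neq_i] := eqVneq i i2; last by rewrite s_i2 orbT.
have eq_j : j2 = j by apply: pivots_distinct piv2 _; rewrite -eq_i.
by move: Mi'j; rewrite -eq_j zero ?eqxx // s_i2 neq_i2 orbT.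
Qed.

Definition upper_triangular (U : 'M['F_2]_m) :=
  forall i j : 'I_m, (j < i)%N -> U i j = 0.

Lemma row_reduceP :
  let U := (row_reduce R (pivot_table R).1).1 in
  upper_triangular U /\
  (forall i j i', is_pivot R i j -> i' != i -> (U *m R) i' j = 0).
Proof.
have [tbl_sound tbl_complete] := pivot_tableP.
move: (pivot_table R).1 tbl_sound tbl_complete => tbl sound complete.
pose P (s : seq 'I_m) (st : 'M['F_2]_m * 'M['F_2]_m) :=
  [/\ st.1 = st.2 *m R, upper_triangular st.2 & cleared s st.1].
rewrite /row_reduce bind_res /=; set st := loop _ _ _.
suff [st_eq upU clr] : P (rev (enum 'I_m)) st.1.
  split=> // i j i' piv neq_i'; have [_ zero] := clr _ _ piv.
  by rewrite -st_eq zero // mem_rev mem_enum neq_i' orbT.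
apply: loop_ind.
  split=> /=; first by rewrite mul1mx.
    by move=> i j lt_ji; rewrite !mxE -val_eqE /= gtn_eqF.
  move=> i j /andP[Rij /forall_inP below]; split=> // i'.
  by rewrite orbF => /below/eqP.
move=> s i {}st _ Pst; rewrite bind_res /=; case E : (tbl i) => [j|] /=; last first.
  have [st_eq upU clr] := Pst; split=> // i1 j1 piv; have [Mij zero] := clr _ _ piv.
  split=> // i' cond; apply: zero; move: cond; rewrite mem_rcons inE.
  by case: eqP => // eq_i; move: E; rewrite -eq_i (complete _ _ piv).
have piv := sound _ _ E.
pose P' (t : seq 'I_m) (st : 'M['F_2]_m * 'M['F_2]_m) :=
  P s st /\ forall i', i' \in t -> st.1 i' j = 0.
set st' := loop _ _ _.
have [[st_eq upU clr] clr_i] : P' [seq i' : 'I_m <- enum 'I_m | i' < i]%N st'.1.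
  apply: loop_ind => [|t i' {Pst st'}st]; first by split.
  rewrite mem_filter => /andP[lt_i' _] [[st_eq upU clr] clr_t].
  rewrite bind_res /=; case: ifPn => [Mi'|/negbNE/eqP Mi']; last first.
    by split=> // i2; rewrite mem_rcons inE => /orP[/eqP->//|/clr_t].
  have neq_i : i' != i by rewrite -val_eqE /= ltn_eqF.
  have [Mij _] := clr _ _ piv.
  split; first split => /=.
  - by rewrite st_eq !row_addE // mulmxA.
  - move=> r c lt_cr; rewrite mxE; case: eqP => [eq_r|_]; last exact: upU.
    by rewrite !upU ?addr0 // -?eq_r // (ltn_trans lt_cr) // eq_r.
  - exact: cleared_row_add piv lt_i' Mi' clr.
  - move=> i2; rewrite mem_rcons inE mxE (F2_neq0 Mi') (F2_neq0 Mij) addF2K.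
    by case: eqP => //= _ /clr_t.
split=> // i2 j2 piv2; have [Mi2 zero] := clr _ _ piv2; split=> // i3.
rewrite mem_rcons inE => /orP[lt_i2|/andP[/orP[/eqP eq_i2|s_i2] neq_i3]].
- by apply: zero; rewrite lt_i2.
- have -> : j2 = j by apply: pivots_distinct piv2 _; rewrite eq_i2.
  have [lt_i3|] := ltnP i3 i; first by apply: clr_i; rewrite mem_filter lt_i3 mem_enum.
  rewrite leq_eqVlt val_eqE -eq_i2 eq_sym (negPf neq_i3) /= => lt_i2.
  have <- : j2 = j by apply: pivots_distinct piv2 _; rewrite eq_i2.
  by apply: zero; rewrite lt_i2.
- by apply: zero; rewrite s_i2 neq_i3 orbT.
Qed.

(** The pivot of a non-zero column clears the rest of it, so a row that carries no
    pivot ends up empty. *)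
Lemma row_reduce_nonpivot i j :
  (pivot_table R).1 i = None -> ((row_reduce R (pivot_table R).1).1 *m R) i j = 0.
Proof.
have [_ tbl_complete] := pivot_tableP; have [_ clr] := row_reduceP.
move=> not_piv; have [/existsP[i0 /exists_pivot[i' piv]]|/existsPn zero] :=
  boolP [exists i0, R i0 j != 0].
  apply: (clr _ _ _ (piv)); apply: contra_eq_neq not_piv => ->.
  by rewrite (tbl_complete _ _ piv).
rewrite mxE big1 // => l _; apply/eqP; rewrite mulf_eq0.
by rewrite (negbNE (zero l)) orbT.
Qed.

End RowReduction.

Section CoboundaryTest.
Local Open Scope ring_scope.
Variables (m : nat) (R : 'M['F_2]_m).

Lemma pivot_table_cost : ((pivot_table R).2 <= m * m.+1)%N.
Proof.
have find_cost rows j : ((find_pivot R rows j).2 <= size rows)%N.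
  by elim: rows => //= i rows IH; case: ifP => _ /=; lia.
rewrite -[X in (_ <= X * _)%N](size_enum_ord m); apply: loop_cost => tbl j _.
rewrite !bind_cost /= addn0 addn1 ltnS (leq_trans (find_cost _ _)) //.
by rewrite size_rev size_enum_ord.
Qed.

Lemma row_reduce_cost tbl : ((row_reduce R tbl).2 <= m * (1 + m * 2))%N.
Proof.
rewrite bind_cost /= addn0 -[X in (_ <= X * _)%N](size_enum_ord m) -size_rev.
apply: loop_cost => st i _; rewrite bind_cost /= leq_add2l.
case: (tbl i) => [j|] //.
apply: leq_trans (_ : size [seq i' : 'I_m <- enum 'I_m | i' < i] * 2 <= _)%N.
  by apply: loop_cost => {}st i' _ /=; case: ifP.
by rewrite leq_mul2r -[X in (_ <= X)%N](size_enum_ord m) size_filter count_size orbT.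
Qed.

Lemma size_last_indices s : (size (last_indices m s) <= m)%N.
Proof. by rewrite size_filter -[X in (_ <= X)%N](size_enum_ord m) count_size. Qed.

Lemma coboundary_test_cost tbl U y s :
  ((@coboundary_test m tbl U y s).2 <= m * m.+1)%N.
Proof.
apply: leq_trans (_ : size (last_indices m s) * m.+1 <= _)%N; last first.
  by rewrite leq_mul2r size_last_indices orbT.
apply: loop_cost => ok r _; rewrite !bind_cost /= addn0 addn1 ltnS.
apply: leq_trans (size_last_indices s); rewrite -[X in (_ <= X)%N]muln1.
exact: loop_cost.
Qed.

(** As U is upper triangular, the rows alive of U see only the coordinates
    alive of y.  These agree with those of R x' for some x', and row r of UR
    vanishes unless r is a pivot. *)
Lemma coboundary_test_complete (A : 'M['F_2]_m) (y x : 'cV['F_2]_m) s :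
  reduced_form A R ->
  (forall c : 'I_m, (m - s <= c)%N -> y c 0 = (A *m x) c 0) ->
  (coboundary_test (pivot_table R).1 (row_reduce R (pivot_table R).1).1 y s).1.
Proof.
case=> [[V defR [upV diagV]] piv] y_alive.
have [upU _] := row_reduceP piv; set U := (row_reduce _ _).1 in upU *.
have unitV : V \in unitmx.
  rewrite unitmxE -det_tr det_trig; last first.
    by apply/is_trig_mxP=> i j lt_ij; rewrite mxE upV.
  by rewrite big1 ?unitr1 // => i _; rewrite mxE diagV.
have defAx : A *m x = R *m (invmx V *m x).
  by rewrite defR -mulmxA (mulmxA V) mulmxV // mul1mx.
apply: (proj1 (loop_rule (P := fun ok => is_true ok) (c := m.+1) _ _)) => // ok r.
rewrite mem_filter => /andP[alive_r _] ->.
split; last first.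
  rewrite !bind_cost /= addn0 addn1 ltnS.
  apply: leq_trans (size_last_indices s); rewrite -[X in (_ <= X)%N]muln1.
  exact: loop_cost.
rewrite !bind_res /=; case E : ((pivot_table R).1 r) => [j|]; first by rewrite orbT.
rewrite orbF (loop_sum _ (w := fun c => U r c * y c 0)) // add0r; apply/eqP.
transitivity ((U *m (A *m x)) r 0).
  rewrite mxE big_filter big_enum_cond /= big_mkcond; apply: eq_bigr => c _.
  case: ifPn => [/y_alive->//|]; rewrite -ltnNge => lt_c.
  by rewrite upU ?mul0r // (leq_trans lt_c).
rewrite defAx mulmxA mxE big1 // => j _.
by rewrite (row_reduce_nonpivot piv) ?mul0r.
Qed.

End CoboundaryTest.

(** * Coordinates in the list of cosimplices *)

Section Coordinates.
Variables (n N k : nat) (X : filtration n N) (In : algo_input k X).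
Local Notation Y := (trunc k X).
Local Notation m := (m_ k X).
Local Notation S := (Sstar In).

Lemma pos_simplices_stage t (tau : {set 'I_n}) :
  tau \in Y t -> 1 < #|tau| -> tau \in pos_simplices k X.
Proof. by move=> Ytau gt1; rewrite inE gt1 (subsetP (trunc_max k X t)). Qed.

Lemma stage_closed t : closed_under_faces (Y t).
Proof. by move=> tau rho; apply: stage_face. Qed.

Lemma card_supp_cochain t p (f : cochain n) : 0 < p -> is_cochain (Y t) p f ->
  #|[set tau | f tau != 0%R]| <= m.
Proof.
move=> p_gt0 /is_cochainP fY; apply/subset_leq_card/subsetP=> tau.
by rewrite inE => /fY[Yt card_tau]; apply: pos_simplices_stage Yt _; rewrite card_tau.
Qed.

Local Notation alive t := (count (mem (Y t)) S).

(** S* lists the simplices in the reverse of an order refining the filtration. *)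
Lemma alive_index (c : 'I_m) t : (m - alive t <= c) = (tnth S c \in Y t).
Proof.
have size_S : size S = m by rewrite size_tuple.
have nthS (j : 'I_m) : nth set0 S j = tnth S j by rewrite -tnth_nth.
have split_count i : alive t = count (mem (Y t)) (take i S) + count (mem (Y t)) (drop i S).
  by rewrite -count_cat cat_take_drop.
have [alive_c|dead_c] := boolP (tnth S c \in Y t).
  apply/idP; rewrite leq_subLR (split_count c).
  have -> : count (mem (Y t)) (drop c S) = m - c.
    rewrite -[X in X - c]size_S -size_drop; apply/eqP; rewrite -all_count; apply/(all_nthP set0).
    move=> i; rewrite size_drop size_S nth_drop => lt_i.
    have lt_ci : c + i < m by rewrite -ltn_subRL.
    rewrite (nthS (Ordinal lt_ci)) /=; apply: (@Sstar_sorted _ _ _ _ In c) => //=.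
    exact: leq_addr.
  have := ltn_ord c; lia.
apply/negbTE; rewrite -ltnNge (split_count c.+1).
have -> : count (mem (Y t)) (take c.+1 S) = 0.
  apply/eqP; rewrite -leqn0 leqNgt -has_count; apply/negP=> /(has_nthP set0)[i].
  rewrite size_take_min size_S => lt_i; rewrite nth_take; last first.
    by rewrite (leq_trans lt_i) // geq_minl.
  have lt_im : i < m by rewrite (leq_trans lt_i) // geq_minr.
  rewrite (nthS (Ordinal lt_im)) /= => alive_i; case/negP: dead_c.
  apply: (Sstar_sorted _ alive_i) => /=.
  by rewrite -ltnS (leq_trans lt_i) // geq_minl.
have := count_size (mem (Y t)) (drop c.+1 S); rewrite size_drop size_S.
have := ltn_ord c; lia.
Qed.

Local Open Scope ring_scope.

(** The cosimplices of S* have positive dimension, so this formula fails for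
    a 0-cochain g. *)
Lemma coboundary_coordinates p (g : cochain n) d (c : 'I_m) :
  (0 < p)%N -> is_cochain (Y d) p g -> tnth S c \in Y d ->
  cobound (Y d) g (tnth S c) =
  (coboundary_mx S *m \col_j g (tnth S j)) c 0.
Proof.
move=> p_gt0 /is_cochainP gY Yc; rewrite ffunE Yc mxE.
set tau := tnth S c.
pose w (rho : {set 'I_n}) := ((rho \subset tau) && (#|tau| == #|rho|.+1))%:R * g rho : 'F_2.
transitivity (\sum_(rho <- S) w rho); last first.
  by rewrite big_tuple; apply: eq_bigr => j _; rewrite !mxE.
rewrite big_uniq ?Sstar_uniq //=.
transitivity (\sum_rho w rho); last first.
  rewrite [RHS]big_mkcond; apply: eq_bigr => rho _; case: ifPn => //.
  rewrite Sstar_mem /w; have [->|/gY[Yrho card_rho]] := eqVneq (g rho) 0.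
    by rewrite mulr0.
  by rewrite (pos_simplices_stage Yrho) // card_rho.
have facets : [set tau :\ v | v in tau] =
              [set rho : {set 'I_n} | (rho \subset tau) && (#|tau| == #|rho|.+1)].
  apply/setP=> rho; rewrite inE; apply/imsetP/andP=> [[v tau_v ->]|[sub_rho card_tau]].
    by rewrite subsetDl [X in X == _](cardsD1 v) tau_v.
  have /cards1P[v def_v] : #|tau :\: rho| == 1%N.
    by rewrite cardsD (setIidPr sub_rho) (eqP card_tau) subSn // subnn.
  have : v \in tau :\: rho by rewrite def_v set11.
  rewrite inE => /andP[rho_v tau_v]; exists v => //; apply/setP=> u; rewrite !inE.
  have /setP/(_ u) := def_v; rewrite !inE => <-.
  by have /implyP := subsetP sub_rho u; case: (u \in rho); case: (u \in tau).
(* v |-> tau :\ v is a bijection from the vertices of tau to its facets. *)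
transitivity (\sum_(rho in [set tau :\ v | v in tau]) g rho).
  rewrite big_imset //= => u v tau_u tau_v /setP/(_ u).
  by rewrite !inE tau_u eqxx; case: eqVneq.
rewrite facets big_mkcond; apply: eq_bigr => rho _; rewrite inE /w.
by case: ifP => _; rewrite ?mul1r ?mul0r.
Qed.

(** A coboundary is spanned by columns of the coboundary matrix as soon as its
    degree is at least two. *)
Lemma coboundary_test_coboundary (f : cochain n) (d b : 'I_N.+1) p :
  (1 < p)%N -> (b <= d)%N -> is_coboundary (Y d) p f ->
  (coboundary_test (pivot_table (Rmx In)).1
     (row_reduce (Rmx In) (pivot_table (Rmx In)).1).1
     (coordinates In f).1 (alive b)).1.
Proof.
case: p => [|p] // p_gt0 le_bd /existsP[g /andP[gY /eqP cob_g]].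
apply: (coboundary_test_complete (x := \col_j g (tnth S j)) (Rmx_reduced In)).
move=> c; rewrite alive_index => /(subsetP (stage_mono Y le_bd)) Yc.
by rewrite -(coboundary_coordinates p_gt0 gY Yc) cob_g mxE.
Qed.

End Coordinates.

(** * The lists of annotated products *)

Lemma cup_unit n (K : {set {set 'I_n}}) p (f : cochain n) :
  closed_under_faces K -> is_cochain K p f -> cup K p f 0 (unit_cochain K) = f.
Proof.
move=> faceK /is_cochainP fK; apply/ffunP=> tau; rewrite !ffunE.
case: ifP => [/andP[Ktau /eqP card_tau]|not_p]; last first.
  apply/esym/eqP; apply: contraFT not_p => /fK[-> ->].
  by rewrite addn0 eqxx.
have [_ card_b union _] := front_backP card_tau.
have sB : back p tau \subset tau by rewrite -{2}union subsetUr.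
rewrite (faceK _ _ Ktau sB) -?card_gt0 ?card_b //= mulr1.
by rewrite /front take_oversize ?set_of_enum // -cardE card_tau addn0.
Qed.

Lemma in_bigcap_seq (T : finType) (I : eqType) (s : seq I) (F : I -> {set T}) x :
  (x \in \bigcap_(i <- s) F i) = all (fun i => x \in F i) s.
Proof. by elim: s => [|i s IHs]; rewrite ?big_nil ?big_cons !inE //= IHs. Qed.

Section Products.
Variables (n N k : nat) (X : filtration n N) (In : algo_input k X).
Local Notation Y := (trunc k X).
Local Notation m := (m_ k X).
Local Notation Q := (q1 In).
Local Notation B := (bars In).
Local Notation sgm := (sigma In).
Local Notation abar := ('I_N.+1 * 'I_N.+1 * cochain n)%type.

(** The annotated bar x of the algorithm is a product of l bars.  Its left end
    is left out, as the right end and the cochain determine it. *)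
Definition represents l (I : l.-tuple 'I_Q) (x : abar) :=
  let d := x.1.2 in
  [/\ x.2 = cups (Y d) (factors B sgm I (Y d)), d \in support_prod Y B sgm I
    & exists2 i, i \in I & dt B i = d].

Lemma sigma_cocycle i : is_cochain (Y (dt B i)) (dg B i) (sgm i).
Proof. by have [/(_ i)/andP[]] := sigma_repr In. Qed.

Lemma dg_gt0 i : 0 < dg B i.
Proof. by have [/(_ i)/andP[]] := bars_barcode In. Qed.

Lemma degree_factors l (I : l.-tuple 'I_Q) K :
  degree_sum (factors B sgm I K) = \sum_(i <- I) dg B i.
Proof. by rewrite /degree_sum big_map. Qed.

Lemma size_le_degree l (I : l.-tuple 'I_Q) : l <= \sum_(i <- I) dg B i.
Proof.
rewrite -[X in X <= _](size_tuple I) -sum1_size.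
by apply: leq_sum => i _; apply: dg_gt0.
Qed.

Lemma restrict_factors l (I : l.-tuple 'I_Q) (t d : 'I_N.+1) : t <= d ->
  restrict (Y t) (cups (Y d) (factors B sgm I (Y d))) =
  cups (Y t) (factors B sgm I (Y t)).
Proof.
move=> le_td.
have factorsE K : factors B sgm I K =
    [seq (x.1, restrict K x.2) | x <- [seq (dg B i, sgm i) | i <- I]].
  by rewrite -map_comp.
by rewrite !factorsE cups_restrict ?stage_mono //; apply: stage_closed.
Qed.

Lemma in_support_prod l (I : l.-tuple 'I_Q) t :
  (t \in support_prod Y B sgm I) =
  all (fun i => t <= dt B i) I &&
  ~~ is_coboundary (Y t) (\sum_(i <- I) dg B i) (cups (Y t) (factors B sgm I (Y t))).
Proof. by rewrite inE. Qed.

Lemma represents_cochain l (I : l.-tuple 'I_Q) x :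
  represents I x -> is_cochain (Y x.1.2) (\sum_(i <- I) dg B i) x.2.
Proof. by case=> -> _ _; rewrite -(degree_factors I (Y x.1.2)); apply: is_cochain_cups. Qed.

Lemma represents_cochain_prod l (I : l.-tuple 'I_Q) x :
  represents I x -> cochain_prod Y B sgm I = x.2.
Proof.
case=> -> ; rewrite in_support_prod => /andP[/allP le_dt _] [i Ii dt_i].
rewrite /cochain_prod; suff -> : \bigcap_(i <- I) Y (dt B i) = Y x.1.2 by [].
apply/setP=> tau; rewrite in_bigcap_seq; apply/allP/idP=> [/(_ i Ii)|Yd j Ij].
  by rewrite dt_i.
exact: subsetP (stage_mono Y (le_dt j Ij)) tau Yd.
Qed.

Lemma represents_end l (I : l.-tuple 'I_Q) x : represents I x ->
  x.1.2 = inord (\max_(t in support_prod Y B sgm I) t).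
Proof.
case=> _ d_supp [i Ii dt_i]; apply: ord_inj; rewrite inordK.
  apply/eqP; rewrite eqn_leq (leq_bigmax_cond _ d_supp) /=.
  apply/bigmax_leqP=> t; rewrite in_support_prod => /andP[/allP/(_ i Ii) le_t _].
  by rewrite -dt_i.
by rewrite ltnS; apply/bigmax_leqP=> t _; rewrite -ltnS.
Qed.

Definition end_cochain (x : abar) := (x.1.2, x.2).

(** Distinctness is asked of the pairs (right end, cochain), which an annotated
    product determines, and not of the triples that the algorithm compares. *)
Definition product_list l (s : seq abar) :=
  uniq (map end_cochain s) /\
  forall x, x \in s -> exists I : l.-tuple 'I_Q, represents I x.

(** The support of a product determines its right end, so distinct entries of
    the list are distinct annotated products. *)
Lemma size_product_list l s : product_list l s -> size s <= #|products Y B sgm l|.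
Proof.
case=> uniq_s repr_s; rewrite cardE -(size_map end_cochain s).
pose h (P : {set 'I_N.+1} * cochain n) : 'I_N.+1 * cochain n :=
  (inord (\max_(t in P.1) t), P.2).
rewrite -(size_map h); apply: uniq_leq_size uniq_s _.
move=> _ /mapP[x /repr_s[I reprI] ->]; apply/mapP.
exists (support_prod Y B sgm I, cochain_prod Y B sgm I).
  rewrite mem_enum; apply/imsetP; exists I => //; rewrite inE.
  by apply/set0Pn; exists x.1.2; case: reprI.
by rewrite /end_cochain /h /= -(represents_end reprI) (represents_cochain_prod reprI).
Qed.

Lemma size_product_list_q l s : 0 < l < k -> product_list l s -> size s <= q_prev In.
Proof.
move=> /andP[l_gt0 lt_lk] /size_product_list/leq_trans; apply.
by apply: leq_bigmax_seq; rewrite // mem_index_iota l_gt0 prednK // (leq_ltn_trans _ lt_lk).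
Qed.

Lemma sigma_not_coboundary i (t : 'I_N.+1) : br B i <= t <= dt B i ->
  ~~ is_coboundary (Y t) (dg B i) (restrict (Y t) (sgm i)).
Proof.
move=> alive_t; have [dg_k _ _] := bars_barcode In.
have [_ /(_ _ t (dg_k i))[_ _ free_s]] := sigma_repr In.
apply/negP=> cob; have := free_s [set i]; rewrite big_set1 => /(_ _ cob).
rewrite sub1set inE eqxx alive_t => /(_ isT)/setP/(_ i).
by rewrite !inE eqxx.
Qed.

Lemma restrict_id K p (f : cochain n) : is_cochain K p f -> restrict K f = f.
Proof.
move=> /is_cochainP fK; apply/ffunP=> tau; rewrite ffunE.
case: ifPn => // notK; apply/esym/eqP; apply: contraNT notK.
by case/fK.
Qed.

(** Bars with the same right end and the same cocycle would have the same degree,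
    and hence be linearly dependent at that end. *)
Lemma product_list_B1 : product_list 1 (B1 In).
Proof.
have [dg_k le_br _] := bars_barcode In.
have [_ basis_s] := sigma_repr In.
split.
  rewrite /B1 -map_comp map_inj_in_uniq ?enum_uniq // => i j _ _ [dt_ij sgm_ij].
  have dg_ij : dg B i = dg B j.
    have [tau f_tau] : exists tau, sgm i tau != 0%R.
      apply/existsP; apply: contraR (sigma_not_coboundary (_ : br B i <= dt B i <= dt B i)).
        move=> /existsPn zero; have -> : sgm i = 0%R.
          by apply/ffunP=> tau; rewrite ffunE; apply/eqP/negbNE/zero.
        rewrite (_ : restrict _ _ = 0%R) ?is_coboundary0 //.
        by apply/ffunP=> tau; rewrite !ffunE if_same.
      by rewrite le_br leqnn.
    have [_ card_i] := is_cochainP _ _ _ (sigma_cocycle i) _ f_tau.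
    rewrite sgm_ij in f_tau.
    have [_] := is_cochainP _ _ _ (sigma_cocycle j) _ f_tau.
    by rewrite card_i => -[].
  have [_ _ /(_ [set i; j])] := basis_s _ (dt B i) (dg_k i).
  have [//|neq_ij] := eqVneq i j.
  rewrite big_setU1 ?inE //= big_set1 sgm_ij addcK is_coboundary0.
  have sij : [set i; j] \subset
      [set i0 | (dg B i0 == dg B i) && (br B i0 <= dt B i <= dt B i0)].
    apply/subsetP=> u; rewrite !inE => /orP[]/eqP->; rewrite ?eqxx ?le_br ?leqnn //.
    by rewrite -dg_ij eqxx [dt B i]dt_ij le_br leqnn.
  by move=> /(_ sij isT)/setP/(_ i); rewrite !inE eqxx.
move=> _ /mapP[i _ ->]; exists [tuple i].
have cupsE t : cups (Y t) (factors B sgm [tuple i] (Y t)) =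
    cup (Y t) (dg B i) (restrict (Y t) (sgm i)) 0 (unit_cochain (Y t)).
  by rewrite /factors /= cups_cons /degree_sum big_nil.
have cupsEdt : cups (Y (dt B i)) (factors B sgm [tuple i] (Y (dt B i))) = sgm i.
  rewrite cupsE (restrict_id (sigma_cocycle i)) cup_unit //.
    exact: stage_closed.
  exact: sigma_cocycle.
split=> /=; last by exists i; rewrite ?mem_head.
  by rewrite cupsEdt.
rewrite in_support_prod /= leqnn big_seq1 cupsEdt -[X in is_coboundary _ _ X](restrict_id (sigma_cocycle i)).
by rewrite sigma_not_coboundary // le_br leqnn.
Qed.

Section Extension.
Variable chk : procedure n N.
Hypothesis chkP : checks_alive Y chk.

(** The cochain stored for a product may live on a larger stage than the new
    product, but the cup product on a stage only sees restrictions to it. *)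
Lemma cup_product_represents l (I : l.-tuple 'I_Q) i x (d : 'I_N.+1) :
  represents I x -> d = (if dt B i <= x.1.2 then dt B i else x.1.2) ->
  (cup_product chk d (sgm i) x.2).1 =
  cups (Y d) (factors B sgm (cons_tuple i I) (Y d)).
Proof.
move=> reprI def_d; have gY := represents_cochain reprI.
have le_d : d <= x.1.2 by rewrite def_d; case: (leqP (dt B i)).
rewrite (cup_product_res chkP _ (dg_gt0 i) (sigma_cocycle i) gY).
rewrite -cup_restrict; last exact: stage_closed.
have [-> _ _] := reprI; rewrite restrict_factors //.
by rewrite /factors /= cups_cons /= degree_factors.
Qed.

Lemma represents_cons l (I : l.-tuple 'I_Q) i x (d b : 'I_N.+1) (f : cochain n) :
  represents I x -> d = (if dt B i <= x.1.2 then dt B i else x.1.2) ->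
  f = (cup_product chk d (sgm i) x.2).1 ->
  ~~ is_coboundary (Y d) (\sum_(j <- cons_tuple i I) dg B j) f ->
  represents (cons_tuple i I) (b, d, f).
Proof.
move=> reprI def_d def_f ncob; have fE := cup_product_represents reprI def_d.
rewrite -def_f in fE; have [_ in_supp [j Ij dt_j]] := reprI.
have le_d : d <= dt B i /\ d <= x.1.2.
  by rewrite def_d; case: (leqP (dt B i)) => [|/ltnW].
split=> //=.
  rewrite in_support_prod -fE ncob andbT /= le_d.1 /=.
  move: in_supp; rewrite in_support_prod => /andP[/allP le_x _].
  by apply/allP=> j' /le_x; apply: leq_trans le_d.2.
rewrite def_d; case: ifP => _; first by exists i; rewrite ?mem_head.
by exists j => //; rewrite inE Ij orbT.
Qed.

Local Notation tbl := (pivot_table (Rmx In)).1.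
Local Notation U := (row_reduce (Rmx In) tbl).1.
Local Notation alive t := (count (mem (Y t)) (Sstar In)).

Definition alive_counts (bs : seq ('I_N.+1 * nat)) :=
  forall x, x \in bs -> x.2 = alive x.1.

Lemma descend_none (y : 'cV['F_2]_m) cands :
  (forall x : 'I_N.+1 * nat, x \in cands -> (coboundary_test tbl U y x.2).1) ->
  (descend tbl U y cands None).1 = None.
Proof.
by case: cands => [|[b s] cands] //= test; rewrite (test (b, s)) ?mem_head.
Qed.

(** The search returns nothing if the test recognizes a coboundary at the largest
    birth time, and a coboundary at d is recognized at all times up to d. *)
Lemma left_end_some (f : cochain n) bs d b p : alive_counts bs -> 1 < p ->
  (left_end tbl U (coordinates In f).1 bs d).1 = Some b ->
  ~~ is_coboundary (Y d) p f.
Proof.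
move=> countsP p_gt1; rewrite /left_end bind_res => some_b.
apply/negP=> cob; move: some_b; rewrite descend_none // => x.
rewrite mem_rev mem_filter => /andP[le_d /countsP->].
exact: coboundary_test_coboundary p_gt1 le_d cob.
Qed.

End Extension.
End Products.

(** * The cost of the algorithm *)

#[local] Arguments loop : simpl never.
#[local] Arguments cup_product : simpl never.
#[local] Arguments coordinates : simpl never.
#[local] Arguments left_end : simpl never.
#[local] Arguments extend : simpl never.
#[local] Arguments while_loop : simpl never.

Section Cost.
Variables (n N k : nat) (X : filtration n N) (In : algo_input k X).
Variable chk : procedure n N.
Local Notation Y := (trunc k X).
Hypothesis chkP : checks_alive Y chk.
Local Notation m := (m_ k X).
Local Notation Q := (q1 In).
Local Notation B := (bars In).
Local Notation sgm := (sigma In).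
Local Notation abar := ('I_N.+1 * 'I_N.+1 * cochain n)%type.
Local Notation tbl := (pivot_table (Rmx In)).1.
Local Notation U := (row_reduce (Rmx In) tbl).1.
Local Notation alive t := (count (mem (Y t)) (Sstar In)).

Lemma size_B1 : size (B1 In) = Q.
Proof. by rewrite size_map size_enum_ord. Qed.

Lemma insert_time_bounds (x : 'I_N.+1) s :
  (insert_time x s).2 <= size s /\ size (insert_time x s).1 <= (size s).+1.
Proof.
elim: s => //= y s [IHc IHs]; case: ifP => _ //=; case: ifP => _ //=.
by lia.
Qed.

Lemma sort_times_bounds (s : seq 'I_N.+1) :
  (sort_times s).2 <= size s * (size s).+1 /\ size (sort_times s).1 <= size s.
Proof.
rewrite /sort_times; suff gen acc :
    let r := loop s acc (fun acc x => tick 1 ;; insert_time x acc) in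
    r.2 <= size s * (size acc + size s).+1 /\ size r.1 <= size acc + size s.
  exact: gen [::].
elim: s acc => [|x s IHs] acc /=; first by lia.
by have [] := insert_time_bounds x acc; have := IHs (insert_time x acc).1; nia.
Qed.

Lemma count_aliveE t : (count_alive In chk t).1 = alive t.
Proof.
rewrite /count_alive loop_res.
have : all (fun tau : {set 'I_n} => 1 < #|tau|) (Sstar In).
  by apply/allP=> tau; rewrite Sstar_mem inE => /andP[].
suff gen s a : all (fun tau : {set 'I_n} => 1 < #|tau|) s ->
    foldl (fun a tau => (tick 1 ;; let* b := chk tau t in ret (a + b)).1) a s =
    a + count (mem (Y t)) s by move/gen->.
elim: s a => [|tau s IHs] a /=; first by rewrite addn0.
by move=> /andP[gt1 /IHs->]; rewrite chkP // addnA.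
Qed.

Lemma count_alive_cost t : (count_alive In chk t).2 <= m * (c_ chk).+1.
Proof.
rewrite -[X in X * _](size_tuple (Sstar In)); apply: loop_cost => a tau _ /=.
by rewrite addn0 add1n ltnS chk_cost.
Qed.

Definition left_end_bound := Q + Q * (m * m.+1).+1.

Lemma left_end_cost tb V (y : 'cV['F_2]_m) bs (d : 'I_N.+1) : size bs <= Q ->
  (left_end tb V y bs d).2 <= left_end_bound.
Proof.
move=> le_bs; rewrite bind_cost; apply: leq_add => //.
apply: (@leq_trans (size (rev [seq x : 'I_N.+1 * nat <- bs | x.1 <= d]) * (m * m.+1).+1)).
  elim: (rev _) None => [|[b s] cands IHc] found //=.
  have := coboundary_test_cost tb V y s.
  by case: ifP => _ /=; have := IHc (Some b); lia.
by rewrite leq_mul2r size_rev size_filter (leq_trans (count_size _ _)) ?orbT.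
Qed.

(** The summands follow the body of the double loop step by step: the product, its
    coordinates, the left end of its support, and the four updates. *)
Definition pair_cost :=
  1 + (m * (1 + m * (c_ chk + 2)) + (m + (left_end_bound + (m.+1 + (Q + (Q + (1 + 0))))))).

(** The left end stored with a product was computed from its right end and its
    cochain.  Hence a triple that is new to the list brings a new pair, and the
    list stays as short as the set of products. *)
Lemma extend_spec l bs ds Bl M : 0 < l -> size bs <= Q -> size ds <= Q ->
  alive_counts In bs -> product_list In l Bl ->
  let r := extend In chk tbl U bs ds l Bl M in
  product_list In l.+1 r.1.1 /\ r.2 <= Q * Q + Q * (1 + size Bl * pair_cost).
Proof.
move=> l_gt0 le_bs le_ds countsP [uniq_Bl repr_Bl] r.
pose P (st : seq abar * seq (seq nat)) := product_list In l.+1 st.1 /\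
  forall x, x \in st.1 -> (left_end tbl U (coordinates In x.2).1 bs x.1.2).1 = Some x.1.1.
suff [[prod_r _] cost_r] : P r.1 /\ r.2 <= Q * Q + Q * (1 + size Bl * pair_cost) by [].
rewrite /r /extend; apply: bind_rule => /=; first by rewrite addn0 leq_mul.
rewrite -size_B1; apply: loop_rule => // st _ /mapP[i _ ->] Pst.
apply: bind_rule => //; apply: loop_rule => // {Pst}st x Bx Pst.
have [[uniq_st repr_st] ends_st] := Pst.
have [I reprI] := repr_Bl x Bx.
set d := if _ then _ else _.
apply: bind_rule => //; apply: bind_rule.
  apply: cup_product_cost; first exact: card_supp_cochain (dg_gt0 i) (sigma_cocycle i).
  apply: card_supp_cochain (represents_cochain reprI).
  exact: leq_trans l_gt0 (size_le_degree I).
set f := (cup_product _ _ _ _).1.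
apply: bind_rule; first by rewrite /= addn0.
apply: bind_rule; first exact: left_end_cost.
case E : (left_end tbl U (coordinates In f).1 bs d).1 => [b|]; last by split.
have reprI' : represents (cons_tuple i I) (b, d, f).
  have := @represents_cons _ _ _ _ In chk chkP _ I i x d b f reprI erefl erefl; apply.
  apply: left_end_some countsP _ E.
  exact: leq_trans _ (size_le_degree (cons_tuple i I)).
apply: bind_rule; first by rewrite /= addn0.
apply: bind_rule; first by rewrite /= addn0 size_map.
apply: bind_rule; first by rewrite /= addn0.
apply: bind_rule; first by [].
split=> //=; split; last first.
  move=> z /=; case: ifP => _; first exact: ends_st.
  by rewrite mem_rcons inE => /orP[/eqP->|/ends_st].
split=> /=.
  case: ifPn => // new; rewrite map_rcons rcons_uniq uniq_st andbT.
  apply: contra new => /mapP[[[b' d'] f'] in_st [eq_d eq_f]].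
  have := ends_st _ in_st; rewrite /= -eq_d -eq_f => E'.
  by have := etrans (esym E) E' => -[eq_b]; rewrite eq_b eq_d eq_f.
move=> z; case: ifP => _; first exact: repr_st.
rewrite mem_rcons inE => /orP[/eqP->|/repr_st//].
by exists (cons_tuple i I).
Qed.

(** The guard of the loop keeps l < k, so the lists processed are bounded by
    q_(k-1). *)
Lemma while_loop_cost fuel l bs ds Bl Mprev M :
  0 < l -> size bs <= Q -> size ds <= Q ->
  alive_counts In bs -> product_list In l Bl ->
  (while_loop In chk fuel tbl U bs ds l Bl Mprev M).2 <=
  fuel.+1 * ((Q * Q).+1 + Q * Q + Q * (1 + q_prev In * pair_cost)).
Proof.
move=> l_gt0 le_bs le_ds countsP.
have tick_cost : (size bs * size ds).+1 <= (Q * Q).+1 by rewrite ltnS leq_mul.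
elim: fuel l Bl Mprev M l_gt0 => [|fuel IHfuel] l Bl Mprev M l_gt0 prodBl.
  by rewrite mul1n -addnA; apply: bind_le.
rewrite mulSn -!addnA; apply: bind_le => //; rewrite addnA.
case: ifP => [/andP[_ le_l]|_] //.
have [prod' cost'] := extend_spec M l_gt0 le_bs le_ds countsP prodBl.
apply: bind_le; last by rewrite addnA; apply: IHfuel.
apply: leq_trans cost' _; rewrite leq_add2l leq_mul2l leq_add2l leq_mul2r.
by rewrite (size_product_list_q _ prodBl) ?orbT // l_gt0; lia.
Qed.

Lemma complexity_steps :
  complexity In chk <=
    Q * Q.+1 + (Q * Q.+1 + (Q * (m * (c_ chk).+1 + 1) + (m * m.+1 +
    (m * (1 + m * 2) + (Q * Q + (Q * Q + (Q * (Q + (Q + (1 + 0))) +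
    (k.+1 * ((Q * Q).+1 + Q * Q + Q * (1 + q_prev In * pair_cost)) + 0)))))))).
Proof.
have [births_cost births_size] := sort_times_bounds [seq x.1.1 | x <- B1 In].
have [deaths_cost deaths_size] := sort_times_bounds [seq x.1.2 | x <- B1 In].
rewrite size_map size_B1 in births_cost births_size.
rewrite size_map size_B1 in deaths_cost deaths_size.
apply: bind_le => //; apply: bind_le => //.
set births := (sort_times _).1 in births_size *; set ds := (sort_times _).1 in deaths_size *.
set add_count := fun bs b => bind _ _.
have [countsP le_bs] : alive_counts In (loop births [::] add_count).1 /\
    size (loop births [::] add_count).1 <= Q.
  have [countsP sizeP] : alive_counts In (loop births [::] add_count).1 /\
      size (loop births [::] add_count).1 = size births.
    apply: (loop_ind (P := fun s bs => alive_counts In bs /\ size bs = size s)) => //.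
    move=> s b bs _ [countsP sizeP]; rewrite /add_count /= !size_rcons sizeP; split=> //.
    move=> x; rewrite mem_rcons inE => /orP[/eqP->/=|/countsP//].
    exact: count_aliveE.
  by rewrite sizeP.
apply: bind_le.
  apply: (@leq_trans (size births * (m * (c_ chk).+1 + 1))); last by rewrite leq_mul2r births_size orbT.
  apply: loop_cost => bs b _; apply: bind_le => //; exact: count_alive_cost.
set bs := (loop births _ _).1 in countsP le_bs *.
apply: bind_le; first exact: pivot_table_cost.
apply: bind_le; first exact: row_reduce_cost.
apply: bind_le; first by rewrite /= addn0 leq_mul.
apply: bind_le; first by rewrite /= addn0 leq_mul.
apply: bind_le.
  rewrite -[X in X * _]size_B1; apply: loop_cost => M x _.
  apply: bind_le; first by rewrite /= addn0 size_map.
  by apply: bind_le; first by rewrite /= addn0.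
apply: bind_le => //; apply: while_loop_cost => //.
exact: product_list_B1.
Qed.

Lemma pair_cost_bound (M W : nat) :
  0 < M -> 0 < W -> m <= M -> Q <= W -> c_ chk <= W ->
  pair_cost <= 15 * (M ^ 2 * W).
Proof.
move=> M_gt0 W_gt0 le_mM le_QW le_cW; set D := M ^ 2 * W.
have le_MD : M <= D by rewrite /D; nia.
have le_WD : W <= D by rewrite /D; nia.
have le_MMD : M * M <= D by rewrite /D; nia.
have cup_le : m * (1 + m * (c_ chk + 2)) <= 4 * D.
  apply: (@leq_trans (M * (1 + M * (W + 2)))); last by rewrite /D; nia.
  by rewrite leq_mul // leq_add2l leq_mul // leq_add2r.
have test_le : left_end_bound <= 4 * D.
  rewrite /left_end_bound; apply: (@leq_trans (W + W * (M * M.+1).+1)).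
    by rewrite leq_add // leq_mul // ltnS leq_mul.
  by rewrite /D; nia.
(* With multiplicities, the sum has at most 15 terms, each at most D. *)
rewrite /pair_cost; lia.
Qed.

(** M, q and W stand for m_k, q_1 and max(c_k, q_1); leaving them free lets the
    cruder bounds be read off as well. *)
Lemma complexity_bound (M q W : nat) :
  0 < M -> 0 < q -> m <= M -> Q <= q -> q <= W -> c_ chk <= W ->
  complexity In chk <= (20 * k + 40) * (M ^ 2 * q * ge1 (q_prev In) * W).
Proof.
move=> M_gt0 q_gt0 le_mM le_Qq le_qW le_cW.
have W_gt0 := leq_trans q_gt0 le_qW.
have pair_le := pair_cost_bound M_gt0 W_gt0 le_mM (leq_trans le_Qq le_qW) le_cW.
have p_gt0 : 0 < ge1 (q_prev In) by rewrite leq_maxl.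
have le_p : q_prev In <= ge1 (q_prev In) by rewrite leq_maxr.
move: (ge1 _) p_gt0 le_p => p p_gt0 le_p.
set D := M ^ 2 * W in pair_le.
have D_gt0 : 0 < D by rewrite muln_gt0 expn_gt0 M_gt0.
have -> : M ^ 2 * q * p * W = D * q * p by rewrite /D; lia.
set T := D * q * p.
have le_qDT : q * D <= T by rewrite /T mulnC leq_pmulr.
have le_DT : D <= T by apply: leq_trans le_qDT; rewrite leq_pmull.
have le_MD : M <= D by rewrite /D; nia.
have le_MMD : M * M <= D by rewrite /D; nia.
have le_MWD : M * W <= D by rewrite /D; nia.
have le_qD : q <= D by rewrite /D; nia.
have QQ : Q * Q <= T by apply: leq_trans le_qDT; rewrite leq_mul // (leq_trans le_Qq).
have QT : Q <= T by lia.
have mm : m * m <= T by apply: leq_trans le_DT; apply: leq_trans le_MMD; rewrite leq_mul.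
have mT : m <= T by lia.
have counting : Q * (m * (c_ chk).+1) <= 2 * T.
  apply: (@leq_trans (q * (2 * D))); last by lia.
  rewrite leq_mul // mulnS (leq_trans (_ : _ <= M + M * W)) //; last by lia.
  by rewrite leq_add // leq_mul.
have extension : Q * (q_prev In * pair_cost) <= 15 * T.
  apply: (@leq_trans (q * (p * (15 * D)))); last by rewrite /T; lia.
  by rewrite !leq_mul.
have iteration : k.+1 * ((Q * Q).+1 + Q * Q + Q * (1 + q_prev In * pair_cost)) <=
                 k.+1 * (19 * T).
  by rewrite leq_mul2l /= mulnDr; lia.
apply: leq_trans complexity_steps _; lia.
Qed.

Lemma complexity_max :
  complexity In chk <=
    (20 * k + 40) * (ge1 m ^ 2 * ge1 Q * ge1 (q_prev In) * maxn (c_ chk) (ge1 Q)).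
Proof. by apply: complexity_bound; rewrite /ge1 ?leq_maxl ?leq_maxr. Qed.

Lemma card_products_le l : #|products Y B sgm l| <= Q ^ l.
Proof.
apply: leq_trans (leq_imset_card _ _) _; apply: leq_trans (max_card _) _.
by rewrite card_tuple card_ord.
Qed.

Lemma bars_le_simplices : Q <= m.
Proof. exact: card_bars_le (bars_barcode In). Qed.

Lemma q_prev_le : q_prev In <= m ^ k.-1.
Proof.
apply/bigmax_leqP_seq => l; rewrite mem_index_iota => /andP[l_gt0 lt_l] _.
apply: leq_trans (card_products_le l) _; apply: (@leq_trans (m ^ l)).
  by rewrite leq_exp2r // bars_le_simplices.
have [->|m_gt0] := posnP m; first by rewrite exp0n.
by rewrite leq_pexp2l // -ltnS.
Qed.

Lemma ge1_q_prev_le : ge1 (q_prev In) <= ge1 m ^ k.-1.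
Proof.
rewrite geq_max expn_gt0 leq_maxl /=; apply: leq_trans q_prev_le _.
have [->|k_gt1] := posnP k.-1; first by [].
by rewrite leq_exp2r // leq_maxr.
Qed.

Lemma ge1_q1_le : ge1 Q <= ge1 m.
Proof. by rewrite geq_max leq_maxl (leq_trans bars_le_simplices) ?leq_maxr. Qed.

End Cost.

(** * The two procedures deciding whether a simplex is alive *)

Lemma scan_mem (T : eqType) (x : T) s : (scan x s).1 = (x \in s).
Proof.
elim: s => //= y s IHs; rewrite inE eq_sym; case: ifP => //= _.
Qed.

Lemma scan_cost (T : eqType) (x : T) s : (scan x s).2 <= size s.
Proof. by elim: s => //= y s IHs; case: ifP => //=. Qed.

Section ScanCheck.
Variables (n N k : nat) (X : filtration n N) (In : algo_input k X).
Local Notation Y := (trunc k X).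

Lemma scan_check_alive : checks_alive Y (scan_check Y (Sstar In)).
Proof.
move=> tau t gt1; rewrite scan_mem.
have size_S : size (Sstar In) = m_ k X by rewrite size_tuple.
set a := m_ k X - _; apply/idP/idP=> [/(nthP set0)[i]|Yt].
  rewrite size_drop size_S nth_drop => lt_i <-.
  have lt_ai : a + i < m_ k X by rewrite -ltn_subRL.
  by rewrite -(tnth_nth set0 _ (Ordinal lt_ai)) -alive_index leq_addr.
have : tau \in Sstar In by rewrite Sstar_mem (pos_simplices_stage Yt).
move=> /tnthP[c def_tau]; rewrite def_tau in Yt *.
rewrite -alive_index in Yt; rewrite (tnth_nth set0).
have -> : nth set0 (Sstar In) c = nth set0 (drop a (Sstar In)) (c - a).
  by rewrite nth_drop subnKC.
by rewrite mem_nth // size_drop size_S ltn_sub2r // (leq_ltn_trans Yt).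
Qed.

Lemma scan_check_cost : c_ (scan_check Y (Sstar In)) <= m_ k X.
Proof.
apply/bigmax_leqP => tau _; apply/bigmax_leqP => t _.
apply: leq_trans (scan_cost _ _) _.
by rewrite size_drop size_tuple leq_subr.
Qed.

End ScanCheck.

Section VietorisRipsCheck.
Variables (R : realDomainType) (n k : nat) (dist : 'I_n -> 'I_n -> R).
Hypothesis dist_ge0 : forall x y, (0 <= dist x y)%R.

(** The maximum computed by the check starts from 0, so that it is compared
    correctly only with non-negative scales. *)
Lemma vr_scale_ge0 (t : 'I_(vr_last dist).+1) : (0 <= vr_scale t)%R.
Proof.
rewrite /vr_scale; have [lt_t|ge_t] := ltnP t (size (vr_values dist)); last first.
  by rewrite nth_default.
have := mem_nth 0%R lt_t; rewrite mem_sort mem_undup => /allpairsP[[x y] [_ _ ->]].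
exact: dist_ge0.
Qed.

Lemma max_loop_le (I : eqType) (s : seq I) (F : R -> I -> comp R)
    (le_r : I -> bool) (r a : R) :
  (forall a x, ((F a x).1 <= r)%R = (a <= r)%R && le_r x) ->
  ((loop s a F).1 <= r)%R = (a <= r)%R && all le_r s.
Proof.
by move=> FE; elim: s a => [|x s IHs] a /=; rewrite ?andbT // IHs FE andbA.
Qed.

Lemma vr_check_alive : checks_alive (trunc k (vr_filtration dist)) (vr_check dist k).
Proof.
move=> tau t gt1; rewrite /vr_check bind_res inE.
case: ifP => [_|_]; last by rewrite andbF.
rewrite andbT inE -card_gt0 (ltnW gt1) /=.
rewrite (@max_loop_le _ _ _ (fun x => all (fun y => (dist x y <= vr_scale t)%R) (enum tau))).
  rewrite vr_scale_ge0 /=; apply/allP/forall_inP => diam x tau_x.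
    by apply/forall_inP=> y tau_y; apply: (allP (diam x _)); rewrite mem_enum.
  rewrite mem_enum in tau_x; apply/allP=> y; rewrite mem_enum.
  exact: (forall_inP (diam x tau_x)).
by move=> a x; apply: max_loop_le => b y; rewrite /= ge_max.
Qed.

Lemma vr_check_cost : c_ (vr_check dist k) <= k.+3 + (k.+2 * k.+2).+1.
Proof.
apply/bigmax_leqP => tau _; apply/bigmax_leqP => t _; apply: bind_le => //.
case: ifP => // le_tau; rewrite cardE in le_tau; rewrite -[X in _ <= X]addn1; apply: bind_le => //.
apply: (@leq_trans (size (enum tau) * k.+2)); last by rewrite leq_mul2r le_tau orbT.
apply: loop_cost => a x _; apply: leq_trans le_tau; rewrite -[X in _ <= X]muln1.
exact: loop_cost.
Qed.

End VietorisRipsCheck.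

(** * The bounds *)

(** Listing the vertices of a simplex, with repetitions, shows that the
    simplices with at most k + 2 vertices are images of functions from a set of
    k + 2 elements. *)
Lemma m_le_vertices n N k (X : filtration n N) : m_ k X <= n ^ k.+2.
Proof.
have sub_im : pos_simplices k X \subset
    [set [set f i | i : 'I_k.+2] | f : {ffun 'I_k.+2 -> 'I_n}].
  apply/subsetP=> tau; rewrite !inE => /andP[/andP[_ le_tau] gt1].
  have [v0 tau_v0] : exists v0, v0 \in tau by apply/set0Pn; rewrite -card_gt0 ltnW.
  apply/imsetP; exists [ffun i : 'I_k.+2 => nth v0 (enum tau) i] => //.
  apply/setP=> v; apply/idP/imsetP=> [tau_v|[i _ ->]].
    have lt_v : index v (enum tau) < k.+2.
      by rewrite (leq_trans _ le_tau) // cardE index_mem mem_enum.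
    by exists (Ordinal lt_v) => //; rewrite ffunE nth_index ?mem_enum.
  rewrite ffunE; have [lt_i|ge_i] := ltnP i (size (enum tau)).
    by rewrite -mem_enum mem_nth.
  by rewrite nth_default.
apply: leq_trans (subset_leq_card sub_im) _.
apply: leq_trans (leq_imset_card _ _) _.
by rewrite card_ffun !card_ord.
Qed.

Theorem theorem20 (k : nat) (hk : 0 < k) :
  (exists C : nat,
     forall (n N : nat) (X : filtration n N) (In : algo_input k X)
            (chk : procedure n N),
       checks_alive (trunc k X) chk ->
       complexity In chk <=
         C * (ge1 (m_ k X) ^ 2 * ge1 (q1 In) * ge1 (q_prev In) *
              maxn (c_ chk) (ge1 (q1 In))))
  /\
  (exists C : nat,
     forall (n N : nat) (X : filtration n N) (In : algo_input k X),
       [/\ q_prev In <= m_ k X ^ k.-1,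
           checks_alive (trunc k X) (scan_check (trunc k X) (Sstar In)),
           c_ (scan_check (trunc k X) (Sstar In)) <= m_ k X
         & forall chk : procedure n N,
             checks_alive (trunc k X) chk -> c_ chk <= m_ k X ->
             complexity In chk <= C * ge1 (m_ k X) ^ (k + 3)])
  /\
  (exists C : nat,
     forall (R : realType) (M : metricType R) (n : nat) (x : 'I_n -> M)
            (hx : bijective x),
       let dist := fun i j : 'I_n => mdist (x i) (x j) in
       let X := vr_filtration dist in
       forall In : algo_input k X,
       [/\ checks_alive (trunc k X) (vr_check dist k),
           complexity In (vr_check dist k) <=
             C * (ge1 (m_ k X) ^ 2 * ge1 (q1 In) ^ 2 * ge1 (q_prev In)),
           ge1 (m_ k X) ^ 2 * ge1 (q1 In) ^ 2 * ge1 (q_prev In) <=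
             C * ge1 (m_ k X) ^ (k + 3)
         & ge1 (m_ k X) ^ (k + 3) <= C * ge1 n ^ (k ^ 2 + 5 * k + 6)]).

Proof.
split; last split.
- by exists (20 * k + 40) => n N X In chk chkP; apply: complexity_max.
- exists (20 * k + 40) => n N X In; split.
  + exact: q_prev_le.
  + exact: scan_check_alive.
  + exact: scan_check_cost.
  move=> chk chkP le_c; have M_gt0 : 0 < ge1 (m_ k X) by rewrite leq_maxl.
  have le_mM : m_ k X <= ge1 (m_ k X) by rewrite leq_maxr.
  apply: leq_trans (complexity_bound chkP M_gt0 M_gt0 le_mM _ (leqnn _) _) _.
  + exact: leq_trans (bars_le_simplices In) le_mM.
  + exact: leq_trans le_c le_mM.
  rewrite leq_mul2l; apply/orP; right.
  apply: (@leq_trans (ge1 (m_ k X) ^ 2 * ge1 (m_ k X) * ge1 (m_ k X) ^ k.-1 * ge1 (m_ k X))).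
    by rewrite leq_mul // leq_mul // ge1_q_prev_le.
  have -> : k + 3 = (3 + k.-1).+1 by lia.
  by rewrite -expnSr -expnD -expnSr.
- pose c := k.+3 + (k.+2 * k.+2).+1.
  exists ((20 * k + 40) * c + 1) => R M n x hx dist X In.
  have chkP : checks_alive (trunc k X) (vr_check dist k).
    by apply: vr_check_alive => i j; apply: mdist_ge0.
  have M_gt0 : 0 < ge1 (m_ k X) by rewrite leq_maxl.
  have q_gt0 : 0 < ge1 (q1 In) by rewrite leq_maxl.
  split; first exact: chkP.
  + apply: leq_trans (complexity_max In chkP) _.
    set T := _ ^ 2 * _ ^ 2 * _.
    apply: (@leq_trans ((20 * k + 40) * (c * T))); last by rewrite mulnA leq_mul2r addn1 leqnSn orbT.
    rewrite leq_mul2l; apply/orP; right.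
    have -> : c * T = ge1 (m_ k X) ^ 2 * ge1 (q1 In) * ge1 (q_prev In) * (c * ge1 (q1 In)).
      by rewrite /T; lia.
    rewrite leq_mul2l geq_max; apply/orP; right.
    rewrite (leq_trans (vr_check_cost _ _)) /=; last by rewrite leq_pmulr.
    by rewrite leq_pmull.
  + apply: (@leq_trans (ge1 (m_ k X) ^ 2 * ge1 (m_ k X) ^ 2 * ge1 (m_ k X) ^ k.-1)).
      by rewrite !leq_mul // ?leq_exp2r ?ge1_q1_le ?ge1_q_prev_le.
    rewrite -!expnD; have -> : 2 + 2 + k.-1 = k + 3 by lia.
    by rewrite leq_pmull // addn1.
  + apply: (@leq_trans (ge1 n ^ (k ^ 2 + 5 * k + 6))); last by rewrite leq_pmull // addn1.
    (* The bound m_k <= n^(k+2) is raised to the power k + 3. *)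
    have -> : k ^ 2 + 5 * k + 6 = k.+2 * (k + 3) by lia.
    rewrite expnM leq_exp2r; last by rewrite addn3.
    rewrite geq_max expn_gt0 leq_maxl /=; apply: leq_trans (m_le_vertices _ _) _.
    by rewrite leq_exp2r // leq_maxr.
Qed.
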